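(* Let $k\ge2$, and let $G^{(k)}$ be the graph with terminals $T_1,\dots,T_{2k-1}$ attached to $t_1,\dots,t_{2k-1}\in V(G_1)$, as defined in the context. Suppose all impurities lie on the boundary: they are placed at locations $I^{(j)}=(I^{(j)}_1,I^{(j)}_2)$ with $I^{(j)}_1=a_j$, $a_j\in\partial G_1$, and $I^{(j)}_2\in\partial G_2$, $j=1,\dots,k$ (where $a_1,\dots,a_k$ are in order along the boundary with no terminals in between). For $1\le j\le k-1$ let $\partial C_j$ be the set of vertices of $\partial G_1$ lying between $a_j$ and $a_{j+1}$. Then the number of corresponding perfect matchings of $G^{(k)}$ is $$M(a_1,\dots,a_k)=\left|\det\begin{pmatrix}L_{a_1,t_1}&L_{a_1,t_2}&\cdots&L_{a_1,t_{2k-1}}\\ L_{a_2,t_1}&L_{a_2,t_2}&\cdots&L_{a_2,t_{2k-1}}\\ \vdots&&&\vdots\\ L_{a_k,t_1}&L_{a_k,t_2}&\cdots&L_{a_k,t_{2k-1}}\\ L_{\partial C_1,t_1}&L_{\partial C_1,t_2}&\cdots&L_{\partial C_1,t_{2k-1}}\\ \vdots&&&\vdots\\ L_{\partial C_{k-1},t_1}&L_{\partial C_{k-1},t_2}&\cdots&L_{\partial C_{k-1},t_{2k-1}}\end{pmatrix}\cdot\det(K)\right|,$$ where $L_{a_j,t_i}=(K^{-1})(a_j,t_i)$ and $L_{\partial C_j,t_i}=\sum_{y\in\partial C_j}(K^{-1})(y,t_i)$.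
   Context: $G_2$ is a finite subgraph of the square lattice and $G_1$ is its dual graph: the vertices of $G_1$ are the bounded faces (unit squares) of $G_2$, two being adjacent iff the faces share an edge. $\partial G_2$ is the set of vertices of $G_2$ on the outer boundary, and $\partial G_1$ is the set of vertices of $G_1$ whose face is incident with an outer boundary edge of $G_2$. $G_{1,T}$ is the graph obtained from $G_1$ by adding $2k-1$ vertices $T_1,\dots,T_{2k-1}$ (terminals) to the boundary of $G_1$: $T_i$ lies in the outer face of $G_2$ and is joined to a vertex $t_i\in\partial G_1$ by an edge crossing an outer boundary edge $f_i$ of $G_2$. The graph $G^{(k)}$ is obtained by superimposing $G_2$ and $G_{1,T}$, extending further edges from the vertices of $\partial G_1$ across the remaining outer boundary edges, placing a vertex wherever two edges meet, and adding diagonal edges. Explicitly, its vertex set is $V(G_1)\cup\{T_i\}\cup V(G_2)\cup\{m_e:e\in E(G_2)\}$, and its edges are: $m_e$ is joined to both endpoints of $e$ and to each bounded face incident with $e$; $m_{f_i}$ is joined to $T_i$; (diagonal edges) each $x\in V(G_1)$ is joined to the four corners of its face in $V(G_2)$, and each $T_i$ is joined to the two endpoints of $f_i$. A perfect matching is a set of edges covering each vertex exactly once. An impurity of a perfect matching of $G^{(k)}$ is an edge of the matching joining a vertex of $G_{1,T}$ to a vertex of $G_2$; every perfect matching has exactly $k$ impurities. The location of an impurity is written $I=(I_1,I_2)$ with $I_1$ in $G_{1,T}$ and $I_2\in V(G_2)$. ''No terminals in between'' means that a portion of the boundary running from $a_1$ through $a_2,\dots,a_{k-1}$ to $a_k$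 carries no terminal; the vertices ''between $a_j$ and $a_{j+1}$'' are those of this portion strictly between them. $K$ is the matrix indexed by $V(G_1)$ with $K(x,x)=4$, $K(x,y)=-1$ if $x,y$ are adjacent in $G_1$, and $K(x,y)=0$ otherwise.
   Formalization: G_2 is taken connected; each I_2^(j) is an endpoint of an outer boundary edge of the face a_j on the portion; ∂C_j counts a vertex once for each outer boundary edge at which the portion meets its face (as a plain set the formula fails, e.g. 5 instead of 6 on a 3×2 rectangle). *)

(* Defs.v *)
From mathcomp Require Import all_boot all_order all_algebra.
From mathcomp Require Import finmap.
From Stdlib Require Import Relation_Operators.

Set Implicit Arguments.
Unset Strict Implicit.
Unset Printing Implicit Defensive.

Import GRing.Theory Num.Theory.
Local Open Scope fset_scope.
Local Open Scope ring_scope.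

(** * The square lattice

    A unit square is named by its lower-left corner.  The lattice edge
    [(p, false)] goes from [p] to [p + (1, 0)], and [(p, true)] goes from [p]
    to [p + (0, 1)]. *)

Definition point : Type := (int * int)%type.
Definition ledge : Type := (point * bool)%type.

Definition shift (p : point) (dx dy : int) : point := (p.1 + dx, p.2 + dy).

Definition ends (e : ledge) : seq point :=
  [:: e.1; if e.2 then shift e.1 0 1 else shift e.1 1 0].

Definition sides (s : point) : seq ledge :=
  [:: (s, false); (shift s 0 1, false); (s, true); (shift s 1 0, true)].

Definition corners (s : point) : seq point :=
  [:: s; shift s 1 0; shift s 1 1; shift s 0 1].

(** * Finite subgraphs of the square lattice and their faces *)

Record lattice_graph : Type := LatticeGraph {
  verts : {fset point};
  edges : {fset ledge};
  edges_ends : forall e, e \in edges -> {subset ends e <= verts}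
}.

Section Faces.
Variable G : lattice_graph.

Definition adj2 : rel (verts G) := fun u v =>
  [exists e : edges G, [&& u != v, val u \in ends (val e)
                                 & val v \in ends (val e)]].

Definition connected_graph : Prop := forall u v : verts G, connect adj2 u v.

(** A face of [G] is a connected component of the plane minus [G], i.e. a
    class of unit squares for the relation generated by crossing a lattice
    edge that is not an edge of [G]; it is the outer face when this class is
    unbounded. *)
Definition cross (s s' : point) : Prop :=
  exists e, [/\ e \notin edges G, e \in sides s & e \in sides s'].

Definition outer_square (s : point) : Prop :=
  forall N : nat, exists2 s',
    clos_refl_trans point cross s s' & (N < absz s'.1 + absz s'.2)%N.

Definition bounded_faces_are_squares : Prop :=
  forall s, ~ outer_square s -> {subset sides s <= edges G}.

(** The vertices of the dual graph [G_1]. *)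
Definition faces : {fset point} :=
  [fset s in verts G | all (mem (edges G)) (sides s)].

Definition adj1 (x y : faces) : bool :=
  (x != y) && has (mem (sides (val y))) (sides (val x)).

Definition outer_edge (e : ledge) : Prop :=
  e \in edges G /\ exists2 s, e \in sides s & outer_square s.

(** [\partial G_1] and [\partial G_2]. *)
Definition boundary1 (x : faces) : Prop :=
  exists2 e, outer_edge e & e \in sides (val x).

Definition boundary2 (v : verts G) : Prop :=
  exists2 e, outer_edge e & val v \in ends e.

End Faces.

(** * Walking along the outer boundary *)

Inductive dir : Type := East | North | West | South.

Definition turn_left (d : dir) : dir :=
  match d with East => North | North => West | West => South | South => East end.

Definition turn_back (d : dir) : dir := turn_left (turn_left d).

Definition turn_right (d : dir) : dir := turn_left (turn_back d).

Definition dart : Type := (point * dir)%type.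

Definition dart_edge (d : dart) : ledge :=
  let: (p, u) := d in
  match u with
  | East => (p, false)
  | North => (p, true)
  | West => (shift p (-1) 0, false)
  | South => (shift p 0 (-1), true)
  end.

Definition dart_head (d : dart) : point :=
  let: (p, u) := d in
  match u with
  | East => shift p 1 0
  | North => shift p 0 1
  | West => shift p (-1) 0
  | South => shift p 0 (-1)
  end.

(** The unit square immediately to the left of a dart. *)
Definition left_square (d : dart) : point :=
  let: (p, u) := d in
  match u with
  | East => p
  | North => shift p (-1) 0
  | West => shift p (-1) (-1)
  | South => shift p 0 (-1)
  end.

Section Boundary.
Variable G : lattice_graph.

(** The successor of a dart on the boundary of the face to its left. *)
Definition next_dart (d : dart) : dart :=
  let h := dart_head d in
  let u := d.2 in
  if dart_edge (h, turn_left u) \in edges G then (h, turn_left u) else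
  if dart_edge (h, u) \in edges G then (h, u) else
  if dart_edge (h, turn_right u) \in edges G then (h, turn_right u) else
  (h, turn_back u).

(** [es] is the sequence of edges met along a portion of the outer boundary,
    followed in either direction and at most once around.  A bridge of [G]
    may be met twice, but is incident with no bounded face. *)
Definition boundary_portion (es : seq ledge) : Prop :=
  exists d n,
    let ds := traject next_dart d n in
    [/\ dart_edge d \in edges G, outer_square G (left_square d),
        (forall i j, (i < j < n)%N -> nth d ds i <> nth d ds j)
      & es = map dart_edge ds \/ es = rev (map dart_edge ds)].

(** The vertices of [\partial G_1] met strictly between the faces [x] and [y],
    for a portion [es] passing [x] at its edge [g] and [y] at its edge [h].
    A face is listed once for each outer boundary edge at which the portion
    meets it: the corner of a rectangle, for instance, is met twice, just as
    two edges of the extended [G_1] leave it across the boundary.  This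
    multiplicity matters: for the 3 x 2 rectangle with [k = 2] and [a_1],
    [a_2] at opposite ends of a portion going around one corner face, summing
    [K^-1] over the underlying set of vertices gives the wrong count. *)
Definition between (es : seq ledge) (g h : ledge) (x y : faces G)
    : seq (faces G) :=
  [seq z <- flatten [seq [seq z <- enum {: faces G} | e \in sides (val z)]
                    | e <- es & (index g es < index e es < index h es)%N]
  | (z != x) && (z != y)].

End Boundary.

(** * The graph [G^(k)] with [n] terminals, and its perfect matchings *)

Section Matchings.
Variables (T : finType) (r : rel T).

Definition perfect_matching (M : {set {set T}}) : bool :=
  [forall e in M, [exists u, exists v, r u v && (e == [set u; v])]]
  && [forall u, #|[set e in M | u \in e]| == 1%N].

End Matchings.

Section TerminalGraph.
Variables (G : lattice_graph) (n : nat) (f : 'I_n -> ledge).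

(** The left summand is the vertex set of [G_{1,T}]; the right one consists of
    [V(G_2)] and of the vertices [m_e]. *)
Definition gk_vertex : finType :=
  ((faces G + 'I_n) + (verts G + edges G))%type.

Definition vertex_face (x : faces G) : gk_vertex := inl (inl x).
Definition vertex_term (i : 'I_n) : gk_vertex := inl (inr i).
Definition vertex_vert (v : verts G) : gk_vertex := inr (inl v).
Definition vertex_edge (e : edges G) : gk_vertex := inr (inr e).

Definition gk_arc (u w : gk_vertex) : bool :=
  match u, w with
  | inr (inr e), inr (inl v) => val v \in ends (val e)
  | inr (inr e), inl (inl x) => val e \in sides (val x)
  | inr (inr e), inl (inr i) => val e == f i
  | inl (inl x), inr (inl v) => val v \in corners (val x)
  | inl (inr i), inr (inl v) => val v \in ends (f i)
  | _, _ => false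
  end.

Definition gk_adj : rel gk_vertex := fun u w => gk_arc u w || gk_arc w u.

Definition impurities (M : {set {set gk_vertex}}) : {set {set gk_vertex}} :=
  [set e in M | [exists u : faces G + 'I_n, exists v : verts G,
                   e == [set (inl u : gk_vertex); vertex_vert v]]].

(** The perfect matchings whose impurities are placed at the locations
    [(a j, b j)]. *)
Definition matchings_with_impurities k (a : 'I_k -> faces G)
    (b : 'I_k -> verts G) : {set {set {set gk_vertex}}} :=
  [set M | perfect_matching gk_adj M
         & impurities M == [set [set vertex_face (a j); vertex_vert (b j)]
                           | j : 'I_k]].

End TerminalGraph.

(** * The matrices *)

Definition Kmx (G : lattice_graph) : 'M[rat]_#|{: faces G}| :=
  \matrix_(i, j) if i == j then 4
                 else if adj1 (enum_val i) (enum_val j) then -1 else 0.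

Definition Linv (G : lattice_graph) (x y : faces G) : rat :=
  invmx (Kmx G) (enum_rank x) (enum_rank y).

Lemma ord_succ_subproof k (j : 'I_k.-1) : (j.+1 < k)%N.
Proof. by rewrite -ltn_predRL. Qed.

(** The indices [j] and [j + 1] among the impurities, for [j] in the range of
    the indices of the intervals [\partial C_j]. *)
Definition ord_this k (j : 'I_k.-1) : 'I_k := widen_ord (leq_pred k) j.
Definition ord_succ k (j : 'I_k.-1) : 'I_k := Ordinal (ord_succ_subproof j).

(** For [k > 0] this is a square matrix of size [k + k.-1 = 2 * k - 1]. *)
Definition impurity_mx (G : lattice_graph) k (a : 'I_k -> faces G)
    (C : 'I_k.-1 -> seq (faces G)) (t : 'I_(k + k.-1) -> faces G)
    : 'M[rat]_(k + k.-1) :=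
  col_mx (\matrix_(j < k, i < k + k.-1) Linv (a j) (t i))
         (\matrix_(j < k.-1, i < k + k.-1) \sum_(y <- C j) Linv y (t i)).

(* Main.v *)
(* The superposition of [G_2] and its dual lives on a refined square lattice,
   whose incidence signs (the boundary maps of [G_2] and of its dual) multiply
   to -1 around each square.  Hence the matchings are counted by a Kasteleyn
   determinant: two matchings differ by cycles, and Euler's formula inside a
   cycle, together with the fact that the vertices inside are matched among
   themselves, gives the sign of each cycle.  The vertices removed by the
   impurities and the terminals are adjacent to the outer face, so they never
   lie inside a cycle.

   As the product of the two boundary maps is zero, multiplying the Kasteleyn
   matrix by face boundaries, by the unit flows along the outer boundary from
   [b_j] to [b_{j+1}], and by flows from [b_1] to the other vertices makes it
   block triangular, with [K] and [K^-1] appearing in the blocks.  These rows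
   generate the integer lattice, because every integral circulation is a
   combination of face boundaries, so the multiplication does not change the
   absolute value of the determinant.  No terminal lies on a flow, and an outer
   boundary edge meets only the face on its inner side: a flow thus contributes
   the sum of the rows of [K^-1] over [\partial C_j], up to multiples of the
   rows of [a_j] and [a_{j+1}]. *)

Require Import Defs.
From mathcomp Require Import all_boot all_order all_fingroup all_algebra.
From mathcomp Require Import finmap zify ring.
From Stdlib Require Import Relation_Operators.

Set Implicit Arguments.
Unset Strict Implicit.
Unset Printing Implicit Defensive.

Import Order.TTheory GRing.Theory Num.Theory.
Local Open Scope ring_scope.

(** * Chains on the square lattice *)

(** No Jordan curve is drawn. Over the two-element field [bool] a cycle has zero divergence, hence
    is the boundary of a unique finitely supported function, and this function plays the part of its
    inside. Likewise Euler's formula is a rank count in a chain complex, used both for the closed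
    region inside a cycle and for the whole graph. The single fact behind all this, exactness of the
    chains of the plane, is proved over an arbitrary nontrivial commutative ring: modulo 2 it
    governs the signs, over the integers it yields the unimodular change of rows. Terminals and
    impurities have no place in the planar picture of the cycles, which is why the sign argument is
    stated for a set [Q] of indices that a permutation preserves and outside which it is the
    identity. *)

Definition boundary (R : comNzRingType) (h : point -> R) (e : ledge) : R :=
  let: (p, vertical) := e in
  if vertical then h (shift p (-1) 0) - h p else h p - h (shift p 0 (-1)).

(** Inflow minus outflow. With edges pointing east and north and squares oriented counterclockwise,
    [boundary] and [divergence] are the two boundary maps of the cellular complex of the plane. *)
Definition divergence (R : comNzRingType) (c : ledge -> R) (p : point) : R :=
  c (shift p (-1) 0, false) - c (p, false) + c (shift p 0 (-1), true)
  - c (p, true).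

Definition far (N : nat) (p : point) : bool :=
  (N < absz p.1)%N || (N < absz p.2)%N.

Definition fin_chain2 (R : comNzRingType) (h : point -> R) : Prop :=
  exists N, forall p, far N p -> h p = 0.

Definition fin_chain1 (R : comNzRingType) (c : ledge -> R) : Prop :=
  exists N, forall e, far N e.1 -> c e = 0.

Lemma int_const (T : Type) (g : int -> T) :
  (forall x, g x = g (x - 1)) -> forall x y, g x = g y.
Proof.
move=> gS.
have gD (n : nat) x : g (x + n%:Z) = g x.
  elim: n => [|n IHn]; first by rewrite addr0.
  by rewrite gS -[RHS]IHn; congr g; lia.
move=> x y; have [le_xy|lt_yx] := lerP x y.
  by rewrite -[RHS](gD `|y - x|%N); rewrite (gD _ y) -(gD `|y - x|%N x);
    congr g; lia.
by rewrite -(gD `|x - y|%N y); congr g; lia.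
Qed.

(** The vertical edges make [h] constant along each row, and every row reaches the region where [h]
    vanishes. *)
Lemma boundary_inj (R : comNzRingType) (h : point -> R) :
  fin_chain2 h -> (forall e, boundary h e = 0) -> forall p, h p = 0.
Proof.
case=> N hN h0 [x y].
rewrite (@int_const _ (fun x' => h (x', y)) _ x (N.+1)%:Z) /=.
  by apply: hN; rewrite /far /= ltnSn.
move=> x'; have /= /subr0_eq := h0 ((x', y), true).
by rewrite /shift /= addr0 => <-.
Qed.

Lemma divergence_boundary (R : comNzRingType) (h : point -> R) p :
  divergence (boundary h) p = 0.
Proof.
case: p => x y; rewrite /divergence /boundary /shift /= !addr0.
ring.
Qed.

(** Integration along rows: the vertical edges prescribe the jumps of [h], and zero divergence makes
    the horizontal edges agree with the result. *)
Lemma exact_chain (R : comNzRingType) (c : ledge -> R) :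
  fin_chain1 c -> (forall p, divergence c p = 0) ->
  exists2 h : point -> R, fin_chain2 h & forall e, boundary h e = c e.
Proof.
case=> N cN c0.
(* [j - N] runs over the abscissas from [-N] to [N], the only ones where [c] can be nonzero. *)
pose h (p : point) := - \sum_(j < N.*2.+1)
  (if j%:Z - N%:Z <= p.1 then c ((j%:Z - N%:Z, p.2), true) else 0).
have hV (x y : int) : h (x - 1, y) - h (x, y) = c ((x, y), true).
  rewrite /h opprK addrC -sumrB /=.
  have [far_x|near_x] := ltnP N (absz x).
    rewrite cN; last by rewrite /far /= far_x.
    rewrite big1 // => j _.
    have lt_j := ltn_ord j.
    have -> : (j%:Z - N%:Z <= x) = (j%:Z - N%:Z <= x - 1) by apply/idP/idP; lia.
    by rewrite subrr.
  have lt_x : (absz (x + N%:Z)%R < N.*2.+1)%N by lia.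
  rewrite (bigD1 (Ordinal lt_x)) //= big1 ?addr0 => [|j /eqP/val_eqP /= ne_j].
    have -> : (absz (x + N%:Z)%R)%:Z - N%:Z = x by lia.
    by rewrite lexx ifF ?subr0 //; apply/negbTE; lia.
  have -> : (j%:Z - N%:Z <= x) = (j%:Z - N%:Z <= x - 1) by apply/idP/idP; lia.
  by rewrite subrr.
(* The defect [g] is constant along a row by zero divergence, and it vanishes to the left of the
   window. *)
have hH (x y : int) : h (x, y) - h (x, y - 1) = c ((x, y), false).
  pose g x := h (x, y) - h (x, y - 1) - c ((x, y), false).
  suff /eqP: g x = 0 by rewrite subr_eq0 => /eqP.
  rewrite (@int_const _ g _ x (- N%:Z - 1)).
    rewrite /g /h cN; last by rewrite /far /=; lia.
    by rewrite !big1 ?subrr //= => j _; rewrite ifF //; lia.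
  move=> {}x; apply/eqP; rewrite -subr_eq0 -(c0 (x, y)) /divergence /g.
  rewrite /shift /= !addr0 -!hV; apply/eqP.
  ring.
exists h; last first.
  by case=> [[x y] []]; rewrite /= /shift /= !addr0 ?hV ?hH.
exists N => [[x y]]; rewrite /far /=.
have far_y y' x' : (N < absz y')%N -> h (x', y') = 0.
  move=> lt_y; rewrite /h big1 ?oppr0 //= => j _.
  by case: ifP => // _; rewrite cN // /far /= lt_y orbT.
case/orP=> [lt_x|]; last exact: far_y.
(* In a column outside the window, [hH] makes [h] constant, so its value can be read at a height
   where it is zero. *)
rewrite -[RHS](far_y N.+1%:Z x) //.
rewrite (@int_const _ (fun y => h (x, y)) _ y N.+1%:Z) // => y'.
apply/eqP; rewrite -subr_eq0 hH cN //.
by rewrite /far lt_x.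
Qed.

(** * Euler's formula *)

Definition edge_head (e : ledge) : point :=
  if e.2 then shift e.1 0 1 else shift e.1 1 0.

Definition other_square (e : ledge) : point :=
  if e.2 then shift e.1 (-1) 0 else shift e.1 0 (-1).

Definition delta (T : eqType) (R : comNzRingType) (x y : T) : R := (y == x)%:R.

Lemma boundary_sum (R : comNzRingType) (I : finType) (u : I -> R)
    (h : I -> point -> R) e :
  boundary (fun p => \sum_i u i * h i p) e = \sum_i u i * boundary (h i) e.
Proof.
by case: e => p [] /=; rewrite -sumrB; apply: eq_bigr => i _; rewrite mulrBr.
Qed.

Lemma divergence_sum (R : comNzRingType) (I : finType) (u : I -> R)
    (c : I -> ledge -> R) p :
  divergence (fun e => \sum_i u i * c i e) p = \sum_i u i * divergence (c i) p.
Proof.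
rewrite /divergence -!(sumrB, big_split) /=.
by apply: eq_bigr => i _; rewrite !(mulrBr, mulrDr).
Qed.

Lemma divergence_delta (R : comNzRingType) (e : ledge) p :
  divergence (delta R e) p = (p == edge_head e)%:R - (p == e.1)%:R.
Proof.
case: e p => [[x y] v] [x' y'];
  rewrite /divergence /delta /edge_head /= /shift /=.
rewrite !xpair_eqE !addr0.
have -> : (x' - 1 == x) = (x' == x + 1) by apply/eqP/eqP; lia.
have -> : (y' - 1 == y) = (y' == y + 1) by apply/eqP/eqP; lia.
by case: v; rewrite /= ?xpair_eqE ?andbF ?andbT ?subr0 ?add0r ?sub0r ?addr0.
Qed.

Lemma mem_sides e s : (e \in sides s) = (s == e.1) || (s == other_square e).
Proof.
case: e s => [[x y] v] [x' y']; rewrite !inE /other_square /shift /= !addr0.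
by case: v; rewrite /= !xpair_eqE /=; apply/idP/idP; lia.
Qed.

Lemma boundary_delta0 (R : comNzRingType) (s : point) e :
  e \notin sides s -> boundary (delta R s) e = 0.
Proof.
rewrite mem_sides negb_or /other_square /boundary /delta;
  case: e => p [] /= /andP[ne1 ne2];
by rewrite ![_ == s]eq_sym (negbTE ne1) (negbTE ne2) subrr.
Qed.

Lemma sum_fset_delta (T : choiceType) (R : comNzRingType) (A : {fset T}) (u : T
    -> R) (x : T) :
  (forall x, x \notin A -> u x = 0) -> \sum_(y : A) u (val y) * delta R (val y)
    x = u x.
Proof.
move=> u0; have [xA|xA] := boolP (x \in A); last first.
  rewrite u0 // big1 // => y _; rewrite /delta; case: eqP => [eq_x|_];
    rewrite ?mulr0 //.
  by rewrite eq_x (valP y) in xA.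
rewrite (bigD1 [` xA]%fset) //= /delta eqxx mulr1 big1 ?addr0 // => y ne_y.
by case: eqP => [eq_x|_]; rewrite ?mulr0 //; case/eqP: ne_y; apply: val_inj.
Qed.

Lemma sum_delta (T : choiceType) (R : comNzRingType) (A : {fset T}) (u : T -> R)
    (x : T) : (forall x, x \notin A -> u x = 0) ->
  \sum_(i < #|{: A}|) u (val (enum_val i)) * delta R (val (enum_val i)) x = u x.
Proof.
by move=> u0; rewrite -(sum_fset_delta x u0) [RHS]big_enum_val.
Qed.

Definition zero_ext (T : choiceType) (R : comNzRingType) (A : {fset T})
    (x : 'rV[R]_#|{: A}|) (p : T) : R :=
  \sum_i x 0 i * delta R (val (enum_val i)) p.

Lemma zero_extE (T : choiceType) (R : comNzRingType) (A : {fset T})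
    (x : 'rV[R]_#|{: A}|) i : zero_ext x (val (enum_val i)) = x 0 i.
Proof.
rewrite /zero_ext (bigD1 i) //= /delta eqxx mulr1 big1 ?addr0 // => j ne_j.
case: eqP => [/val_inj/enum_val_inj eq_j|]; last by rewrite mulr0.
by rewrite eq_j eqxx in ne_j.
Qed.

Lemma zero_ext_out (T : choiceType) (R : comNzRingType) (A : {fset T})
    (x : 'rV[R]_#|{: A}|) p : p \notin A -> zero_ext x p = 0.
Proof.
move=> pA; rewrite /zero_ext big1 // => i _; rewrite /delta.
case: eqP => [eq_p|]; last by rewrite mulr0.
by rewrite eq_p (valP (enum_val i)) in pA.
Qed.

Lemma fin_chain2_fset (R : comNzRingType) (A : {fset point}) (u : point -> R) :
  (forall x, x \notin A -> u x = 0) -> fin_chain2 u.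
Proof.
move=> u0; exists (\max_(x : A) maxn (absz (val x).1) (absz (val x).2))%N => p
  far_p.
apply: u0; apply/negP => pA; move: far_p; apply/negP.
have := @leq_bigmax _ (fun x : A => maxn (absz (val x).1) (absz (val x).2))%N
  [` pA]%fset.
by rewrite /far geq_max negb_or -!leqNgt.
Qed.

Lemma fin_chain1_fset (R : comNzRingType) (A : {fset ledge}) (u : ledge -> R) :
  (forall x, x \notin A -> u x = 0) -> fin_chain1 u.
Proof.
move=> u0; exists (\max_(x : A) maxn (absz (val x).1.1) (absz (val x).1.2))%N
  => p far_p.
apply: u0; apply/negP => pA; move: far_p; apply/negP.
have := @leq_bigmax _ (fun x : A => maxn (absz (val x).1.1) (absz (val
  x).1.2))%N [` pA]%fset.
by rewrite /far geq_max negb_or -!leqNgt.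
Qed.

(** Alternating dimension count in the exact sequence from faces to edges to vertices to [K]. The
    map [A] is injective by [boundary_inj]; the kernel of [B] is the image of [A] by [exact_chain],
    the last hypothesis keeping the primitive inside [F]; connectivity makes the kernel of [B^T] the
    line of constant functions. *)
Lemma euler (K : fieldType) (V F : {fset point}) (E : {fset ledge}) :
    (forall e, e \in E -> {subset ends e <= V}) ->
    (forall s, s \in F -> {subset sides s <= E}) ->
    V != fset0 ->
    (forall phi : point -> K, (forall e, e \in E -> phi (edge_head e) = phi
      e.1) ->
       {in V &, forall u v, phi u = phi v}) ->
    (forall h : point -> K, fin_chain2 h ->
       (forall e, e \notin E -> boundary h e = 0) ->
       forall s, s \notin F -> h s = 0) ->
  (#|{: V}| + #|{: F}| = #|{: E}| + 1)%N.
Proof.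
move=> endsV sidesE V0 conn exactF.
pose A : 'M[K]_(#|{: F}|, #|{: E}|) :=
  \matrix_(i, j) boundary (delta K (val (enum_val i))) (val (enum_val j)).
pose B : 'M[K]_(#|{: E}|, #|{: V}|) :=
  \matrix_(j, v) divergence (delta K (val (enum_val j))) (val (enum_val v)).
have divB0 (e : E) p : p \notin V -> divergence (delta K (val e)) p = 0.
  move=> pV; rewrite divergence_delta.
  have V1 : (val e).1 \in V by apply: (endsV (val e));
    rewrite ?(valP e) ?mem_head.
  have V2 : edge_head (val e) \in V.
    by apply: (endsV (val e)); rewrite ?(valP e) // !inE eqxx orbT.
  have /negbTE-> : p != edge_head (val e) by apply: contraNneq pV => ->.
  have /negbTE-> : p != (val e).1 by apply: contraNneq pV => ->.
  by rewrite subrr.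
have AE (x : 'rV_ _) (e : E) :
    (x *m A) 0 (enum_rank e) =
    boundary (zero_ext x) (val e).
  by rewrite boundary_sum !mxE; apply: eq_bigr => i _; rewrite !mxE enum_rankK.
have A0 (s : F) e : e \notin E -> boundary (delta K (val s)) e = 0.
  move=> eE; apply: boundary_delta0; apply/negP => es.
  by case/negP: eE; apply: sidesE es; apply: valP.
have Afree : row_free A.
  rewrite -kermx_eq0; apply/eqP/row_matrixP => r; rewrite row0.
  have : row r (kermx A) *m A = 0 by rewrite -row_mul mulmx_ker row0.
  set x := row r _ => xA0; clearbody x; apply/rowP => i; rewrite mxE.
  rewrite -zero_extE; apply: boundary_inj => [|e].
    by apply: (@fin_chain2_fset _ F) => p; apply: zero_ext_out.
  have [eE|eE] := boolP (e \in E).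
    by rewrite -(AE x [` eE]%fset) xA0 mxE.
  by rewrite boundary_sum big1 // => j _; rewrite A0 ?mulr0.
have AB0 : A *m B = 0.
  apply/matrixP => i v; rewrite !mxE -[RHS](divergence_boundary
    (delta K (val (enum_val i))) (val (enum_val v))).
  transitivity (divergence (fun e => \sum_(j < #|{: E}|)
      boundary (delta K (val (enum_val i))) (val (enum_val j)) *
      delta K (val (enum_val j)) e) (val (enum_val v))).
    by rewrite divergence_sum; apply: eq_bigr => j _; rewrite !mxE.
  have eq_c e := @sum_delta _ _ E (boundary (delta K (val (enum_val i)))) e (A0
    _).
  by rewrite /divergence !eq_c.
have kerB : (kermx B <= A)%MS.
  apply/row_subP => r; have : row r (kermx B) *m B = 0 by rewrite -row_mul
    mulmx_ker row0.
  set y := row r _ => yB0; clearbody y.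
  pose c := zero_ext y;
    have c0 e : e \notin E -> c e = 0 by apply: zero_ext_out.
  have [|p|h finh hc] := @exact_chain _ c; first exact: fin_chain1_fset c0.
    rewrite divergence_sum; have [pV|pV] := boolP (p \in V); last first.
      by rewrite big1 // => j _; rewrite divB0 ?mulr0.
    transitivity ((y *m B) 0 (enum_rank [` pV]%fset)); last by rewrite yB0 mxE.
    by rewrite mxE; apply: eq_bigr => j _; rewrite mxE enum_rankK.
  have h0 s : s \notin F -> h s = 0.
    by apply: exactF => // e eE; rewrite hc c0.
  pose x : 'rV[K]_#|{: F}| := \row_i h (val (enum_val i)).
  apply/submxP; exists x; apply/rowP => j; rewrite -[j]enum_valK AE.
  have eq_h p : zero_ext x p = h p.
    by rewrite -(sum_delta p h0); apply: eq_bigr => i _; rewrite mxE.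
  transitivity (c (val (enum_val j))); last first.
    by rewrite -hc; case: (val _) => p [] /=; rewrite !eq_h.
  by rewrite enum_valK /c zero_extE.
have rkA : \rank A = #|{: F}| by apply/eqP.
have rk_kerB : (\rank (kermx B) = #|{: F}|)%N.
  rewrite -rkA; apply/eqP; rewrite eqn_leq !mxrankS //.
  by apply/sub_kermxP.
have /fset0Pn[v0 v0V] := V0.
have rk_kerBt : (\rank (kermx B^T) = 1)%N.
  pose w : 'rV[K]_#|{: V}| := const_mx 1.
  have w_neq0 : w != 0.
    apply/eqP => /rowP/(_ (enum_rank [` v0V]%fset)); rewrite !mxE => /eqP.
    by rewrite oner_eq0.
  have rkw : \rank w = 1%N by rewrite rank_rV w_neq0.
  have w_ker : w *m B^T = 0.
    apply/rowP => j; rewrite !mxE.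
    under eq_bigr do rewrite !mxE mul1r divergence_delta.
    rewrite sumrB.
    have sum1 p : p \in V -> \sum_(i < #|{: V}|) ((val (enum_val i) == p)%:R :
      K) = 1.
      move=> pV; rewrite (bigD1 (enum_rank [` pV]%fset)) //= enum_rankK eqxx.
      rewrite big1 ?addr0 // => i ne_i; case: eqP => // eq_i.
      case/negP: ne_i; apply/eqP/enum_val_inj; rewrite enum_rankK;
        exact: val_inj.
    rewrite !sum1 ?subrr //; apply: (endsV (val (enum_val j)));
      rewrite ?(valP (enum_val j)) //.
      exact: mem_head.
    by rewrite !inE eqxx orbT.
  apply/eqP; rewrite -[X in _ == X]rkw eqn_leq !mxrankS //;
    first by apply/sub_kermxP.
  apply/row_subP => r; have : row r (kermx B^T) *m B^T = 0.
    by rewrite -row_mul mulmx_ker row0.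
  set x := row r _ => xB0; clearbody x.
  pose phi := zero_ext x.
  have phi_const : {in V &, forall u v, phi u = phi v}.
    apply: conn => e eE; apply/eqP; rewrite -subr_eq0 /phi /zero_ext -sumrB.
    apply/eqP; transitivity ((x *m B^T) 0 (enum_rank [` eE]%fset));
      last by rewrite xB0 mxE.
    rewrite mxE; apply: eq_bigr => i _;
      rewrite !mxE enum_rankK divergence_delta -mulrBr.
    by rewrite /delta ![_ == val (enum_val _)]eq_sym.
  apply/submxP; exists (phi v0)%:M; apply/rowP => i.
  by rewrite mul_scalar_mx !mxE mulr1 -zero_extE; apply: phi_const;
    rewrite // (valP (enum_val i)).
have rkB1 := mxrank_ker B; have rkB2 := mxrank_ker B^T.
have := rank_leq_col B; have := rank_leq_row B.
rewrite mxrank_tr in rkB2; rewrite rk_kerB in rkB1; rewrite rk_kerBt in rkB2.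
by clear -rkB1 rkB2; lia.
Qed.

(** * Kasteleyn signs *)

Lemma mem_ends e p : (p \in ends e) = (p == e.1) || (p == edge_head e).
Proof. by rewrite !inE. Qed.

Lemma edge_head_neq e : edge_head e != e.1.
Proof. by case: e => [[x y] []]; rewrite /edge_head /shift /= xpair_eqE;
  lia. Qed.

Lemma other_square_neq e : other_square e != e.1.
Proof. by case: e => [[x y] []]; rewrite /other_square /shift /= xpair_eqE;
  lia. Qed.

Lemma ends_corners q e : e \in sides q -> {subset ends e <= corners q}.
Proof.
case: q => qx qy; rewrite !inE => /or4P[] /eqP -> p;
  rewrite !inE /edge_head /shift /=;
by case: p => px py; rewrite !xpair_eqE; lia.
Qed.

Lemma uniq_sides q : uniq (sides q).
Proof. by case: q => x y; rewrite /= !inE /shift !xpair_eqE /=; lia. Qed.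

Lemma mem_corners p q : (p \in corners q) = 
  [|| q == p, q == shift p (-1) 0, q == shift p (-1) (-1) | q == shift p 0
    (-1)].
Proof. by case: p q => [x y] [x' y']; rewrite !inE /shift !xpair_eqE /=;
  lia. Qed.

Lemma boundary_bool (h : point -> bool) e :
  boundary h e = h e.1 (+) h (other_square e).
Proof. by case: e => p [] /=; rewrite /other_square //= addbC. Qed.

Lemma ends_inj e e' : ends e =i ends e' -> e = e'.
Proof.
case: e e' => [[x y] v] [[x' y'] v'] eq_e.
have := eq_e (x, y); have := eq_e (edge_head ((x, y), v)).
have := eq_e (x', y'); have := eq_e (edge_head ((x', y'), v')).
rewrite !inE /edge_head /shift; case: v {eq_e}; case: v' => /=;
  rewrite !xpair_eqE;
  move=> h1 h2 h3 h4; [congr (_, _, _) | exfalso | exfalso | congr (_, _, _)];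
    lia.
Qed.

Lemma big_mem_uniq (R : Type) (idx : R) (op : Monoid.com_law idx)
    (T : choiceType) (A : {fset T}) (s : seq T) (u : T -> R) :
  uniq s -> {subset s <= A} ->
  \big[op/idx]_(x : A | val x \in s) u (val x) = \big[op/idx]_(x <- s) u x.
Proof.
move=> s_uniq sA; rewrite -(big_seq_fsetE _ _ (fun x => x \in s)) -big_filter.
apply: perm_big; apply: uniq_perm => //; first by rewrite filter_uniq.
by move=> x; rewrite mem_filter; apply: andb_idr => /sA.
Qed.

Lemma fin_chain2_support (h : point -> bool) :
  fin_chain2 h -> exists A : {fset point}, forall p, (p \in A) = h p.
Proof.
case=> N hN; pose g i : int := i%:Z - N%:Z;
  pose r := [seq g i | i <- iota 0 N.*2.+1].
have r_x (x : int) : (absz x <= N)%N -> x \in r.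
  by move=> le_x; apply/mapP; exists (absz (x + N%:Z)); rewrite ?mem_iota /g;
    lia.
have [L L_near] : exists L : seq point, forall p, ~~ far N p -> p \in L.
  exists [seq (x, y) | x <- r, y <- r] => p.
  rewrite /far negb_or -!leqNgt => /andP[/r_x px /r_x py].
  by apply/allpairsPdep; exists p.1, p.2; split=> //; case: (p).
exists [fset p in L | h p]%fset => p; rewrite !inE; apply: andb_idl => hp.
by apply: L_near; apply: contraTN hp => /hN ->.
Qed.

(* A Kasteleyn gauge: these sign bits add up to 1 around every unit square. *)
Definition kasteleyn_bit (e : ledge) : bool :=
  if e.2 then ~~ (odd (absz e.1.1) (+) odd (absz e.1.2)) else ~~ odd (absz
    e.1.1).

Lemma kasteleyn_square q : \sum_(e <- sides q) kasteleyn_bit e = true.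
Proof.
case: q => x y; rewrite !big_cons big_nil /kasteleyn_bit /shift /= !addr0.
have -> : odd (absz (x + 1)) = ~~ odd (absz x) by lia.
by case: (odd _) (odd _) => [] [].
Qed.

(** * The closed region covered by a finite set of squares *)

Definition squares_at (p : point) : seq point :=
  [:: p; shift p (-1) 0; shift p (-1) (-1); shift p 0 (-1)].

Lemma mem_corners_at p q : (p \in corners q) = (q \in squares_at p).
Proof. by rewrite mem_corners !inE. Qed.

Lemma constant_around (h : point -> bool) p :
    (forall e, p \in ends e -> boundary h e = false) ->
  {in squares_at p, forall q, h q = h p}.
Proof.
case: p => x y h0; have h1 e : (x, y) \in ends e -> h e.1 = h (other_square e).
  by move/h0; rewrite boundary_bool; case: (h _) (h _) => [] [].
have eq1 := h1 ((x, y), false) (mem_head _ _).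
have eq2 := h1 ((x, y), true) (mem_head _ _).
have /h1 : (x, y) \in ends ((x - 1, y), false) by rewrite mem_ends /edge_head
  /shift /= !xpair_eqE; lia.
move: eq1 eq2; rewrite /other_square /shift /= !addr0 => eq1 eq2 eq3 q.
by rewrite !inE /shift /= !addr0 => /or4P[] /eqP->;
  rewrite // -?eq3 -?eq2 -?eq1.
Qed.

Definition touched_verts (A : {fset point}) : {fset point} :=
  [fset p in flatten [seq corners q | q <- A]]%fset.

Definition touched_edges (A : {fset point}) : {fset ledge} :=
  [fset e in flatten [seq sides q | q <- A]]%fset.

Lemma touched_vertsP (A : {fset point}) p :
  reflect (exists2 q, q \in A & p \in corners q) (p \in touched_verts A).
Proof. by rewrite in_fset; apply: (iffP flatten_mapP). Qed.

Lemma touched_edgesP (A : {fset point}) e :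
  reflect (exists2 q, q \in A & e \in sides q) (e \in touched_edges A).
Proof. by rewrite in_fset; apply: (iffP flatten_mapP). Qed.

Lemma in_touched_edges (A : {fset point}) e :
  (e \in touched_edges A) = (e.1 \in A) || (other_square e \in A).
Proof.
apply/touched_edgesP/orP => [[q qA]|].
  by rewrite mem_sides => /orP[] /eqP <-; [left | right].
by case=> eA; [exists e.1 | exists (other_square e)];
  rewrite // mem_sides eqxx ?orbT.
Qed.

(** * The cycle formed by one orbit in the superposition of two matchings *)

Section OneCycle.
Variables (I : finType) (pi : {perm I}) (i0 : I).
Variables (x y : I -> point) (a b : I -> ledge).
Let O := porbit pi i0.
Hypothesis (x_inj : {in O &, injective x}) (y_inj : {in O &, injective y}).
Hypothesis (xy : forall i j, i \in O -> j \in O -> x i != y j).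
Hypothesis (ends_a : forall i, i \in O -> ends (a i) =i [:: x i; y i]).
Hypothesis (ends_b : forall i, i \in O -> ends (b i) =i [:: x (pi i); y i]).
Hypothesis (moved : pi i0 != i0).

(** The cycle reads [x i], [a i], [y i], [b i], [x (pi i)], and so on along the orbit; [moved]
    excludes the degenerate case of an edge doubled by both matchings. *)
Definition cycle_edges : seq ledge := [seq a i | i in O] ++ [seq b i | i in O].
Definition on_cycle (p : point) : bool :=
  [exists i in O, (p == x i) || (p == y i)].

Lemma O_pi i : (pi i \in O) = (i \in O).
Proof.
rewrite /O -!eq_porbit_mem; congr (_ == _).
exact: (porbit_perm pi 1).
Qed.

Lemma O_moved i : i \in O -> pi i != i.
Proof.
case/porbitP=> n ->; rewrite -permM -expgSr expgS permM.
by rewrite (inj_eq perm_inj).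
Qed.

Lemma mem_ends2 (p q : point) e : ends e =i [:: p; q] ->
  forall r, r \in ends e = (r == p) || (r == q).
Proof. by move=> eq_e r; rewrite eq_e !inE. Qed.

Lemma a_inj : {in O &, injective a}.
Proof.
move=> i j iO jO eq_a; apply: x_inj => //; apply/eqP.
have := mem_ends2 (ends_a jO) (x i); rewrite -eq_a ends_a // mem_head.
by rewrite (negbTE (xy iO jO)) orbF => /esym.
Qed.

Lemma b_inj : {in O &, injective b}.
Proof.
move=> i j iO jO eq_a; apply: y_inj => //; apply/eqP.
have := mem_ends2 (ends_b jO) (y i); rewrite -eq_a ends_b // !inE eqxx orbT.
by rewrite eq_sym (negbTE (xy _ iO)) ?O_pi // => /esym.
Qed.

Lemma ab_neq i j : i \in O -> j \in O -> a i != b j.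
Proof.
move=> iO jO; apply/eqP => eq_ab; have pijO : pi j \in O by rewrite O_pi.
have := mem_ends2 (ends_b jO) (y i); rewrite -eq_ab ends_a // !inE eqxx orbT.
rewrite eq_sym (negbTE (xy pijO iO)) /= => /esym/eqP/(y_inj iO jO) eq_ij.
have := mem_ends2 (ends_b jO) (x i); rewrite -eq_ab ends_a // !inE eqxx /=.
rewrite (negbTE (xy iO jO)) orbF eq_ij => /esym/eqP/(x_inj jO pijO) /eqP.
by rewrite eq_sym (negbTE (O_moved jO)).
Qed.

Lemma uniq_cycle_edges : uniq cycle_edges.
Proof.
rewrite cat_uniq; apply/and3P; split.
- by rewrite map_inj_in_uniq ?enum_uniq // => i j; rewrite !mem_enum;
    apply: a_inj.
- apply/hasPn => e /imageP[j jO ->]; apply/negP => /imageP[i iO /eqP].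
  by rewrite eq_sym (negbTE (ab_neq _ _)).
- by rewrite map_inj_in_uniq ?enum_uniq // => i j; rewrite !mem_enum;
    apply: b_inj.
Qed.

Lemma size_cycle_edges : size cycle_edges = (#|O|.*2)%N.
Proof. by rewrite size_cat !size_map -cardE addnn. Qed.

Lemma a_cycle i : i \in O -> a i \in cycle_edges.
Proof. by move=> iO; rewrite mem_cat image_f. Qed.

Lemma b_cycle i : i \in O -> b i \in cycle_edges.
Proof. by move=> iO; rewrite mem_cat image_f ?orbT. Qed.

Lemma cycle_edges_ends e : e \in cycle_edges -> {in ends e, forall p, on_cycle
    p}.
Proof.
rewrite mem_cat => /orP[] /imageP[i iO ->] p.
  by rewrite ends_a // !inE => ?; apply/existsP; exists i; rewrite iO.
rewrite ends_b // !inE => /orP[] eq_p; apply/existsP.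
  by exists (pi i); rewrite O_pi iO eq_p.
by exists i; rewrite iO eq_p orbT.
Qed.

Lemma divergence_bool (e : ledge) (p q r : point) : ends e =i [:: p;
    q] -> p != q ->
  divergence (delta bool e) r = ((r == p) (+) (r == q)) :> bool.
Proof.
move=> eq_e ne_pq; rewrite divergence_delta.
have -> : (r == p) (+) (r == q) = (r \in ends e).
  by rewrite eq_e !inE; case: (r =P p) => [->|//]; rewrite (negbTE ne_pq).
rewrite mem_ends; have := edge_head_neq e.
by case: (r =P edge_head e) => [->|] /=; [move=> /negbTE -> | case: (r == e.1)].
Qed.

Lemma divergence_cycle (z : ledge -> bool) p :
    (forall e, e \notin cycle_edges -> z e = false) ->
  divergence z p =
    \sum_(i in O) (z (a i) * ((p == x i) (+) (p == y i))
                 + z (b i) * ((p == x (pi i)) (+) (p == y i))).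
Proof.
move=> z0.
have zE e : z e = \sum_(i in O) z (a i) * delta bool (a i) e
                + \sum_(i in O) z (b i) * delta bool (b i) e.
  have -> (c : I -> ledge) : \sum_(i in O) z (c i) * delta bool (c i) e =
      \sum_(e' <- [seq c i | i in O]) z e' * delta bool e' e.
    by rewrite big_map big_enum.
  have -> (c : I -> ledge) : \sum_(i in O) z (c i) * delta bool (c i) e =
      \sum_(e' <- [seq c i | i in O]) z e' * delta bool e' e.
    by rewrite big_map big_enum.
  rewrite -big_cat -/cycle_edges;
    have [e_in|/[dup] eN /z0 ->] := boolP (e \in cycle_edges).
    rewrite (bigD1_seq e) ?uniq_cycle_edges //= /delta eqxx mulr1 big1 ?addr0
      // => e'.
    by rewrite eq_sym => /negbTE->; rewrite mulr0.
  rewrite big_seq big1 // => e' e'_in; rewrite /delta; case: eqP => [eq_e|];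
    last by rewrite mulr0.
  by rewrite -eq_e (negbTE eN) in e'_in.
have -> : divergence z p = divergence (fun e => 
    \sum_i (if i \in O then z (a i) else 0) * delta bool (a i) e) p +
     divergence (fun e => \sum_i (if i \in O then z (b i) else 0) * delta bool
       (b i) e) p.
  have E c e : \sum_(i in O) z (c i) * delta bool (c i) e =
       \sum_i (if i \in O then z (c i) else 0) * delta bool (c i) e.
    by rewrite big_mkcond; apply: eq_bigr => i _; case: ifP => //;
      rewrite mul0r.
  rewrite /divergence !zE -!E; ring.
rewrite !divergence_sum -big_split [RHS]big_mkcond; apply: eq_bigr => i _ /=.
case: ifP => iO; last by rewrite !mul0r.
rewrite (divergence_bool _ (ends_a iO)) ?xy // (divergence_bool _ (ends_b iO))
  //.
by rewrite xy ?O_pi.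
Qed.

(** Each point of the cycle is an end of one edge [a] and one edge [b], so the divergence vanishes
    modulo 2. The function obtained is the indicator of the inside. *)
Lemma cycle_chain :
  exists2 h : point -> bool, fin_chain2 h & forall e, boundary h e = (e \in
    cycle_edges).
Proof.
apply: exact_chain => [|p].
  apply: (@fin_chain1_fset _ [fset e in cycle_edges]%fset). move=> e;
    rewrite in_fset.
  by move=> /negbTE ->.
rewrite divergence_cycle => [|e /negbTE //].
transitivity (\sum_(i in O) ((p == x i) : bool) + \sum_(i in O) ((p == x (pi
  i)) : bool)).
  rewrite -big_split; apply: eq_bigr => i iO; rewrite a_cycle ?b_cycle //.
  by case: (p == x i) (p == y i) (p == x (pi i)) => [] [] [].
set s1 := (X in X + _); set s2 := (X in _ + X); have -> : s1 = s2.
  by rewrite /s1 (reindex_inj (@perm_inj _ pi)); apply: eq_bigl => i;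
    exact: O_pi.
by case: s2.
Qed.

(** Only two edges of the cycle meet at a point, so zero divergence makes their coefficients equal,
    and the equality propagates around the orbit. *)
Lemma cycle_chain_const (z : ledge -> bool) :
    (forall e, e \notin cycle_edges -> z e = false) ->
    (forall p, divergence z p = 0) ->
  {in cycle_edges, forall e, z e = z (a i0)}.
Proof.
move=> z0 divz.
have zab i : i \in O -> z (a i) = z (b i).
  move=> iO; have := divz (y i);
    rewrite divergence_cycle // (bigD1 i) //= big1 ?addr0.
    rewrite eqxx ![y i == x _]eq_sym !(negbTE (xy _ _)) ?O_pi //= !mulr1.
    by case: (z _) (z _) => [] [].
  move=> j /andP[jO ne_j];
    rewrite ![y i == x _]eq_sym !(negbTE (xy _ _)) ?O_pi //=.
  by rewrite (inj_in_eq y_inj) // eq_sym (negbTE ne_j) !mulr0.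
have zba i : i \in O -> z (a (pi i)) = z (b i).
  move=> iO; have piO : pi i \in O by rewrite O_pi.
  have := divz (x (pi i));
    rewrite divergence_cycle // big_split /= (bigD1 (pi i)) //= big1.
    rewrite (bigD1 i) //= big1;
      first rewrite !addr0 !eqxx !(negbTE (xy _ _)) //= !mulr1.
      by case: (z _) (z _) => [] [].
    move=> j /andP[jO ne_j];
      rewrite (negbTE (xy _ _)) // (inj_in_eq x_inj) ?O_pi //.
    by rewrite (inj_eq perm_inj) eq_sym (negbTE ne_j) mulr0.
  move=> j /andP[jO ne_j]; rewrite (negbTE (xy _ _)) // (inj_in_eq x_inj) //.
  by rewrite eq_sym (negbTE ne_j) mulr0.
have za i : i \in O -> z (a i) = z (a i0).
  case/porbitP=> n ->; elim: n => [|n IHn]; first by rewrite perm1.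
  have nO : (pi ^+ n)%g i0 \in O by exact: mem_porbit.
  by rewrite expgSr permM zba // -zab.
by move=> e; rewrite mem_cat => /orP[] /imageP[i iO ->]; rewrite -?zab // za.
Qed.

(** * Euler's formula and Kasteleyn signs inside a cycle *)

Section Inside.
Variables (h : point -> bool) (A : {fset point}).
Hypotheses (fin_h : fin_chain2 h) (hA : forall p, (p \in A) = h p).
Hypothesis (bd_h : forall e, boundary h e = (e \in cycle_edges)).
Let V := touched_verts A.
Let E := touched_edges A.

Lemma cycle_edges_touched : {subset cycle_edges <= E}.
Proof.
move=> e; rewrite -bd_h boundary_bool in_touched_edges !hA.
by case: (h _) (h _) => [] [].
Qed.

Lemma touched_ends e : e \in E -> {subset ends e <= V}.
Proof.
case/touched_edgesP => q qA eq p pe; apply/touched_vertsP; exists q => //.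
exact: ends_corners pe.
Qed.

(** No edge at such a point belongs to the cycle, so [h] does not change around it. *)
Lemma interior_squares p : p \in V -> ~~ on_cycle p ->
  {in squares_at p, forall q, q \in A}.
Proof.
case/touched_vertsP=> q qA; rewrite mem_corners_at => pq pN.
have hp : {in squares_at p, forall q, h q = h p}.
  apply: constant_around => e pe; rewrite bd_h; apply: contraNF pN => e_cyc.
  exact: cycle_edges_ends pe.
by move=> q' pq'; rewrite hA hp // -(hp q) // -hA.
Qed.

Lemma interior_edges p e : p \in V -> ~~ on_cycle p -> p \in ends e -> e \in E.
Proof.
have e_side : e \in sides e.1 by rewrite mem_sides eqxx.
move=> pV pN pe; apply/touched_edgesP; exists e.1 => //.
by apply: interior_squares pV pN _ _; rewrite -mem_corners_at;
  apply: ends_corners pe.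
Qed.

(** The cycle is connected, and from a point off the cycle a step to the west stays in the region;
    as the region is bounded, such steps end on the cycle. *)
Lemma touched_connected (phi : point -> bool) :
    (forall e, e \in E -> phi (edge_head e) = phi e.1) ->
  {in V &, forall u v, phi u = phi v}.
Proof.
move=> phiE.
have phi_ends e p q : e \in E -> p \in ends e -> q \in ends e -> phi p = phi q.
  by move=> /phiE eq_e; rewrite !mem_ends => /orP[] /eqP-> /orP[] /eqP->.
have phi_a i : i \in O -> phi (x i) = phi (y i).
  move=> iO; apply: (phi_ends (a i));
    first exact: cycle_edges_touched (a_cycle iO).
    by rewrite ends_a ?mem_head.
  by rewrite ends_a // !inE eqxx orbT.
have phi_b i : i \in O -> phi (x (pi i)) = phi (y i).
  move=> iO; apply: (phi_ends (b i));
    first exact: cycle_edges_touched (b_cycle iO).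
    by rewrite ends_b ?mem_head.
  by rewrite ends_b // !inE eqxx orbT.
have phi_x i : i \in O -> phi (x i) = phi (x i0).
  case/porbitP=> n ->; elim: n => [|n IHn]; first by rewrite perm1.
  have nO : (pi ^+ n)%g i0 \in O by exact: mem_porbit.
  by rewrite expgSr permM phi_b // -phi_a.
have phi_cycle p : on_cycle p -> phi p = phi (x i0).
  by case/existsP=> i /andP[iO /orP[] /eqP->]; rewrite -?phi_a // phi_x.
case: fin_h => N hN.
have phi_V n : forall p, p \in V -> (absz (p.1 + N%:Z)%R < n)%N -> phi p = phi
  (x i0).
  elim: n => // n IHn p pV lt_n.
  have [/phi_cycle //|pN] := boolP (on_cycle p).
  have sqA := interior_squares pV pN.
  have eE : (shift p (-1) 0, false) \in E.
    apply/touched_edgesP; exists (shift p (-1) 0); last exact: mem_head.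
    by apply: sqA; rewrite !inE eqxx orbT.
  have ends1 : p \in ends (shift p (-1) 0, false).
    by case: (p) => p1 p2; rewrite mem_ends /edge_head /shift /= !xpair_eqE;
      lia.
  rewrite (phi_ends _ _ (shift p (-1) 0) eE ends1) ?mem_head //; apply: IHn.
    by apply: touched_ends eE _ _; apply: mem_head.
  have : shift p (-1) 0 \in A by apply: sqA; rewrite !inE eqxx orbT.
  rewrite hA => h1; have : ~~ far N (shift p (-1) 0) by apply: contraTN h1 =>
    /hN ->.
  by case: (p) lt_n => p1 p2; rewrite /far /shift /=; lia.
by move=> u v uV vV; rewrite !(phi_V _ _ _ (ltnSn _)).
Qed.

(** The part [h2] of [h'] outside [h] has its boundary on the cycle, so by [cycle_chain_const] it is
    zero or equal to [h]; either way it vanishes outside [A]. *)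
Lemma touched_exact (h' : point -> bool) : fin_chain2 h' ->
  (forall e, e \notin E -> boundary h' e = 0) -> forall q, q \notin A -> h' q =
    0.
Proof.
move=> [N' fin_h'] h'0; pose h2 q := h' q && ~~ h q.
have fin_h2 : fin_chain2 h2 by exists N' => q /fin_h'; rewrite /h2 => ->.
have z0 e : e \notin cycle_edges -> boundary h2 e = false.
  rewrite -bd_h !boundary_bool /h2 => /negPn.
  have [eE|eN] := boolP (e \in E).
    move: eE; rewrite in_touched_edges !hA.
    by case: (h _) => /=; case: (h _) => //=; rewrite !andbF.
  move: (h'0 e eN); move: eN;
    rewrite in_touched_edges !hA negb_or boundary_bool.
  by case: (h _) (h _) => [] [] //= _; rewrite !andbT.
have const := cycle_chain_const z0 (divergence_boundary h2).
have {}z0 e : boundary h2 e = boundary h2 (a i0) && boundary h e.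
  rewrite bd_h; have [e_in|e_out] := boolP (e \in _);
    first by rewrite const ?andbT.
  by rewrite z0 ?andbF.
have h2E q : h2 q = boundary h2 (a i0) && h q.
  case: (boundary h2 (a i0)) z0 => z0 /=; last by apply: boundary_inj.
  apply/eqP; rewrite -subr_eq0; apply/eqP.
  pose h3 q := h2 q - h q; rewrite -/(h3 q).
  apply: boundary_inj => [|e].
    case: fin_h2 fin_h => [N1 fin1] [N2 fin2]; exists (maxn N1 N2) => p far_p.
    rewrite /h3 fin1 ?fin2 //; move: far_p; rewrite /far; lia.
  transitivity (boundary h2 e - boundary h e); last by rewrite z0 subrr.
  by rewrite /h3; case: (e) => p [] /=; ring.
move=> q; rewrite hA => hq; have := h2E q; rewrite /h2 (negbTE hq) andbT andbF.
by [].
Qed.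

Lemma sum_sides e :
  (\sum_(q : A) (e \in sides (val q)) = h e.1 + h (other_square e))%N.
Proof.
have sum1 p : (\sum_(q : A) (val q == p) = h p)%N.
  rewrite -hA; have [pA|pA] := boolP (p \in A); last first.
    by rewrite big1 // => q _; case: eqP => // eq_q;
      rewrite -eq_q (valP q) in pA.
  rewrite (bigD1 [` pA]%fset) //= eqxx big1 // => q ne_q.
  by case: eqP => // eq_q; case/negP: ne_q; apply/eqP/val_inj.
rewrite -!sum1 -big_split; apply: eq_bigr => q _; rewrite mem_sides /=.
have := other_square_neq e; case: (val q =P e.1) => [->|_ _] //=.
by rewrite eq_sym => /negbTE->.
Qed.

(** An edge of the region either borders two of its squares, or borders one and lies on the cycle:
    both kinds contribute 2 to the count. *)
Lemma edge_count : (#|{: E}|.*2 = #|{: A}| * 4 + #|O|.*2)%N.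
Proof.
transitivity (\sum_(e : E) ((val e \in cycle_edges) + (\sum_(q : A) (val e \in
  sides (val q)))))%N.
  rewrite -muln2 -sum_nat_const; apply: eq_bigr => e _.
  rewrite sum_sides -bd_h boundary_bool.
  have := valP e; rewrite in_touched_edges !hA.
  by case: (h _) (h _) => [] [].
have sum_uniq (s : seq ledge) : uniq s -> {subset s <= E} ->
    (\sum_(e : E) (val e \in s) = size s)%N.
  move=> s_uniq sE; rewrite -sum1_size -(big_mem_uniq _ _ s_uniq sE)
    [RHS]big_mkcond.
  by apply: eq_bigr => e _; case: (_ \in _).
rewrite big_split /= exchange_big /= addnC sum_uniq ?uniq_cycle_edges //;
  last exact: cycle_edges_touched.
rewrite size_cycle_edges -sum_nat_const; congr (_ + _)%N; apply: eq_bigr => q _.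
by rewrite sum_uniq ?uniq_sides // => e eq; apply/touched_edgesP;
  exists (val q); rewrite ?(valP q).
Qed.

Lemma euler_inside : (#|{: V}| + #|{: A}| = #|{: E}| + 1)%N.
Proof.
apply: (@euler bool).
- exact: touched_ends.
- by move=> q qA e eq; apply/touched_edgesP; exists q.
- apply/fset0Pn; exists (x i0); apply: (@touched_ends (a i0)).
    by apply: cycle_edges_touched; rewrite a_cycle ?porbit_id.
  by rewrite ends_a ?porbit_id // mem_head.
- exact: touched_connected.
- exact: touched_exact.
Qed.

(** Summing [kasteleyn_square] over the inside cancels the interior edges and leaves the parity of
    [#|A|]. By [euler_inside] and [edge_count], [#|V| = #|A| + #|O| + 1], so an even [#|V|]
    determines that parity. *)
Lemma kasteleyn_inside : ~~ odd #|{: V}| ->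
  \sum_(i in O) (kasteleyn_bit (a i) + kasteleyn_bit (b i)) = ~~ odd #|O| :>
    bool.
Proof.
move=> evenV.
have -> : \sum_(i in O) (kasteleyn_bit (a i) + kasteleyn_bit (b i)) =
    \sum_(e <- cycle_edges) kasteleyn_bit e.
  by rewrite big_split big_cat !big_map !big_enum.
transitivity (\sum_(q : A) true : bool); last first.
  have -> : \sum_(q : A) true = odd #|{: A}| :> bool.
    rewrite sumr_const; elim: (#|_|) => // n IHn; rewrite mulrS IHn /=.
    by case: (odd n).
  by have := euler_inside; have := edge_count; move: evenV; rewrite -/V; lia.
rewrite -(big_mem_uniq _ _ uniq_cycle_edges cycle_edges_touched) big_mkcond.
under [RHS]eq_bigr => q _.
  rewrite -(kasteleyn_square (val q)) -(big_mem_uniq (A := E) _ _ (uniq_sides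
    _)); last first.
    by move=> e eq; apply/touched_edgesP; exists (val q); rewrite ?(valP q).
  rewrite big_mkcond; over.
rewrite exchange_big; apply: eq_bigr => e _ /=.
transitivity (\sum_(q : A) (val e \in sides (val q)) * kasteleyn_bit (val e));
  last first.
  by apply: eq_bigr => q _; case: ifP; rewrite ?mul1r ?mul0r.
rewrite -mulr_suml.
have -> : \sum_(q : A) ((val e \in sides (val q)) : bool) =
    odd (\sum_(q : A) (val e \in sides (val q)))%N.
  elim/big_rec2: _ => // q m c _ ->; rewrite oddD; by case: (_ \in _).
rewrite sum_sides oddD !oddb -boundary_bool bd_h.
by case: (_ \in _); rewrite ?mul1r ?mul0r.
Qed.

End Inside.
End OneCycle.

(** * The sign of the permutation relating two matchings *)

Section Kasteleyn.
Variables (I : finType) (pi : {perm I}) (Q : {pred I}).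
Variables (x y : I -> point) (a b : I -> ledge).
Hypothesis (Q_pi : forall i, i \in Q -> pi i \in Q).
Hypothesis (pi_notQ : forall i, i \notin Q -> pi i = i).
Hypothesis (x_inj : {in Q &, injective x}) (y_inj : {in Q &, injective y}).
Hypothesis (xy : forall i j, i \in Q -> j \in Q -> x i != y j).
Hypothesis (ends_a : forall i, i \in Q -> ends (a i) =i [:: x i; y i]).
Hypothesis (ends_b : forall i, i \in Q -> ends (b i) =i [:: x (pi i); y i]).

Definition matched (p : point) : bool :=
  [exists i in Q, (p == x i) || (p == y i)].

Hypothesis inside_matched : forall h : point -> bool, fin_chain2 h ->
  (forall e, boundary h e -> {in ends e, forall p, matched p}) ->
  forall q, h q -> {in corners q, forall p, matched p}.

(** The closed region has an even number of points because the edges [a i] pair them: each of its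
    points is matched by [inside_matched], and an edge [a i] with an end off the cycle and in the
    region has both ends there. *)
Lemma kasteleyn_orbit i0 : i0 \in Q ->
  \sum_(i in porbit pi i0) (kasteleyn_bit (a i) + kasteleyn_bit (b i)) =
    ~~ odd #|porbit pi i0| :> bool.
Proof.
move=> i0Q; have [fix0|moved] := eqVneq (pi i0) i0.
  have porb1 : porbit pi i0 = [set i0].
    apply/setP=> j; rewrite inE; apply/porbitP/eqP => [[n ->]|->];
      last by exists 0%N; rewrite perm1.
    by elim: n => [|n IHn]; rewrite ?perm1 // expgSr permM IHn.
  rewrite porb1 big_set1 cards1 /=.
  have -> : a i0 = b i0.
    by apply: ends_inj => p; rewrite ends_a // ends_b // fix0.
  by case: (kasteleyn_bit _).
pose O := porbit pi i0.
have OQ : {subset O <= Q}.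
  by move=> i /porbitP[n ->]; elim: n => [|n IHn];
    rewrite ?perm1 // expgSr permM Q_pi.
have xO : {in O &, injective x} by move=> i j /OQ iQ /OQ; apply: x_inj.
have yO : {in O &, injective y} by move=> i j /OQ iQ /OQ; apply: y_inj.
have xyO i j : i \in O -> j \in O -> x i != y j by move=> /OQ iQ /OQ; apply: xy.
have aO i : i \in O -> ends (a i) =i [:: x i; y i] by move/OQ; apply: ends_a.
have bO i : i \in O -> ends (b i) =i [:: x (pi i); y i] by move/OQ;
  apply: ends_b.
have [h fin_h bd_h] := cycle_chain xO yO xyO aO bO moved.
have [A hA] := fin_chain2_support fin_h.
apply: (kasteleyn_inside xO yO xyO aO bO moved fin_h hA bd_h).
have on_matched p : on_cycle pi i0 x y p -> matched p.
  by case/existsP=> i /andP[/OQ iQ eq_p]; apply/existsP; exists i;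
    rewrite iQ eq_p.
have V_matched p : p \in touched_verts A -> matched p.
  case/touched_vertsP=> q; rewrite hA => hq; apply: inside_matched hq _ => // e.
  by rewrite bd_h => /(cycle_edges_ends aO bO) e_on r /e_on /on_matched.
set V := touched_verts A in V_matched *.
have VO i : i \in O -> (x i \in V) /\ (y i \in V).
  move=> iO; have aE := cycle_edges_touched hA bd_h (a_cycle a b iO).
  have endV := touched_ends aE.
  by split; apply: endV; rewrite aO // !inE eqxx ?orbT.
have xV_yV i : i \in Q -> (x i \in V) = (y i \in V).
  move=> iQ; have [/VO[-> ->] //|iN] := boolP (i \in O).
  have xN : ~~ on_cycle pi i0 x y (x i).
    apply/existsP => -[j /andP[jO]]; rewrite (negbTE (xy iQ (OQ _ jO))) orbF.
    by move=> /eqP/(x_inj iQ (OQ _ jO)) eq_ij; rewrite eq_ij jO in iN.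
  have yN : ~~ on_cycle pi i0 x y (y i).
    apply/existsP => -[j /andP[jO]];
      rewrite eq_sym (negbTE (xy (OQ _ jO) iQ)) /=.
    by move=> /eqP/(y_inj iQ (OQ _ jO)) eq_ij; rewrite eq_ij jO in iN.
  have xE : x i \in ends (a i) by rewrite ends_a // mem_head.
  have yE : y i \in ends (a i) by rewrite ends_a // !inE eqxx orbT.
  apply/idP/idP => pV.
    by apply: (touched_ends (interior_edges aO bO hA bd_h pV xN xE)).
  by apply: (touched_ends (interior_edges aO bO hA bd_h pV yN yE)).
pose S := [set i in Q | x i \in V].
have SQ i : i \in S -> i \in Q by rewrite inE => /andP[].
suff eqV : perm_eq V ([seq x i | i in S] ++ [seq y i | i in S]).
  by rewrite -cardfE (perm_size eqV) size_cat !size_map addnn odd_double.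
apply: uniq_perm => [||p]; first exact: fset_uniq.
  rewrite cat_uniq !map_inj_in_uniq ?enum_uniq ?andbT //=.
  - apply/hasPn => p /imageP[j /SQ jQ ->]; apply/negP => /imageP[i /SQ iQ /eqP].
    by rewrite eq_sym (negbTE (xy _ _)).
  - by move=> i j; rewrite !mem_enum => /SQ iQ /SQ; apply: y_inj.
  - by move=> i j; rewrite !mem_enum => /SQ iQ /SQ; apply: x_inj.
rewrite mem_cat; apply/idP/orP.
  move=> /[dup] pV /V_matched /existsP[i /andP[iQ /orP[] /eqP eq_p]];
    [left|right].
    by rewrite eq_p image_f // inE iQ -eq_p.
  by rewrite eq_p image_f // inE iQ xV_yV -?eq_p.
by case=> /imageP[i]; rewrite inE => /andP[iQ xV] ->; rewrite // -xV_yV.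
Qed.

(** The sign of [pi] is the product of the signs of its orbits, which [kasteleyn_orbit] supplies;
    orbits outside [Q] are singletons. *)
Lemma kasteleyn :
  \sum_(i in Q) (kasteleyn_bit (a i) + kasteleyn_bit (b i)) = odd_perm pi :>
    bool.
Proof.
transitivity (\sum_(O in porbits pi) ~~ odd #|O| : bool); last first.
  have -> : odd_perm pi = odd (\sum_(O in porbits pi) #|O|) (+) odd #|porbits
    pi|.
    congr (odd _ (+) _); rewrite -sum1_card (partition_big_imset (porbit pi))
      /=.
    apply: eq_bigr => O /imsetP[i _ ->]; rewrite -sum1_card.
    by apply: eq_bigl => j; rewrite eq_porbit_mem.
  rewrite -[#|porbits pi|]sum1_card !(big_morph odd oddD (erefl _)) -big_split.
  by apply: eq_bigr => O _ /=; case: odd.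
have -> : \sum_(i in Q) (kasteleyn_bit (a i) + kasteleyn_bit (b i)) =
   \sum_i if i \in Q then kasteleyn_bit (a i) + kasteleyn_bit (b i) else false.
  exact: big_mkcond.
rewrite (partition_big_imset (porbit pi)) /=.
have porbQ i j : j \in porbit pi i -> (j \in Q) = (i \in Q).
  have imp i' j' : j' \in porbit pi i' -> i' \in Q -> j' \in Q.
    by case/porbitP=> n ->; elim: n => [|n IHn] iQ;
      rewrite ?perm1 // expgSr permM Q_pi ?IHn.
  by move=> ji; apply/idP/idP; apply: imp; rewrite // porbit_sym.
rewrite -/(porbits pi); apply: eq_bigr => O /imsetP[i0 _ ->].
under eq_bigl do rewrite eq_porbit_mem.
have [i0Q|i0N] := boolP (i0 \in Q).
  rewrite -(kasteleyn_orbit i0Q); apply: eq_bigr => i i_i0.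
  by rewrite (porbQ _ _ i_i0) i0Q.
rewrite big1 => [|i i_i0]; last by rewrite (porbQ _ _ i_i0) (negbTE i0N).
suff -> : porbit pi i0 = [set i0] by rewrite cards1.
apply/setP=> j; rewrite inE; apply/porbitP/eqP => [[n ->]|->];
  last by exists 0%N; rewrite perm1.
by elim: n => [|n IHn]; rewrite ?perm1 // expgSr permM IHn pi_notQ.
Qed.

End Kasteleyn.

(** * The refined lattice *)

(** Doubling the coordinates makes room for the dual graph: vertices get two even coordinates, faces
    two odd ones, edges one of each. *)
Definition vert_pos (v : point) : point := (2 * v.1, 2 * v.2).
Definition face_pos (s : point) : point := (2 * s.1 + 1, 2 * s.2 + 1).
Definition edge_pos (e : ledge) : point :=
  if e.2 then (2 * e.1.1, 2 * e.1.2 + 1) else (2 * e.1.1 + 1, 2 * e.1.2).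

(** The fine edge from the midpoint of [e] to [v], meaningful only when [v] is an end of [e]: [d] is
    0 at the tail and 1 at the head. In [face_link], [d] likewise tells [e.1] from
    [other_square e]. *)
Definition vert_link (e : ledge) (v : point) : ledge :=
  let d : int := (v != e.1)%:R in
  if e.2 then ((2 * e.1.1, 2 * e.1.2 + d), true)
  else ((2 * e.1.1 + d, 2 * e.1.2), false).

Definition face_link (e : ledge) (s : point) : ledge :=
  let d : int := (s != e.1)%:R in
  if e.2 then ((2 * e.1.1 - d, 2 * e.1.2 + 1), false)
  else ((2 * e.1.1 + 1, 2 * e.1.2 - d), true).

Lemma ends_vert_link e v : v \in ends e ->
  ends (vert_link e v) =i [:: edge_pos e; vert_pos v].
Proof.
case: e v => [[x y] w] [vx vy]; rewrite mem_ends => /orP[] /eqP -> p;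
rewrite /vert_link ?eqxx ?edge_head_neq !inE /edge_head /edge_pos /vert_pos
  /shift;
by case: w; case: p => p1 p2 /=; rewrite !xpair_eqE; lia.
Qed.

Lemma ends_face_link e s : e \in sides s ->
  ends (face_link e s) =i [:: edge_pos e; face_pos s].
Proof.
case: e s => [[x y] w] [vx vy]; rewrite mem_sides => /orP[] /eqP -> p;
rewrite /face_link ?eqxx ?other_square_neq !inE /other_square /edge_pos
  /face_pos /shift;
by case: w; case: p => p1 p2 /=; rewrite !xpair_eqE; lia.
Qed.

(** The origin of [kasteleyn_bit]: on doubled coordinates its parities tell the tail of an edge from
    its head, so that Kasteleyn signs are incidence numbers and identities between chains apply to
    the matrix. *)
Lemma divergence_sign e v :
  divergence (delta int e) v =
    if v \in ends e then (-1) ^+ kasteleyn_bit (vert_link e v) else 0.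
Proof.
rewrite divergence_delta mem_ends; have ne := edge_head_neq e.
have [->|ne1] := eqVneq v e.1.
  rewrite eq_sym (negbTE ne) /vert_link eqxx /kasteleyn_bit;
    case: (e) => [[x y] []] /=.
    have -> : odd (absz (2 * x)%R) = false by lia.
    by have -> : odd (absz (2 * y + 0)%R) = false by lia.
  by have -> : odd (absz (2 * x + 0)%R) = false by lia.
have [->|ne2] := eqVneq v (edge_head e); last by rewrite subrr.
rewrite orbT /vert_link ne /kasteleyn_bit; case: (e) => [[x y] []] /=.
  have -> : odd (absz (2 * x)%R) = false by lia.
  by have -> : odd (absz (2 * y + 1)%R) = true by lia.
by have -> : odd (absz (2 * x + 1)%R) = true by lia.
Qed.

Lemma boundary_sign e s :
  boundary (delta int s) e =
    if e \in sides s then (-1) ^+ kasteleyn_bit (face_link e s) else 0.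
Proof.
case: ifP => [|/negbT]; last exact: boundary_delta0.
have ne := other_square_neq e; rewrite mem_sides => /orP[] /eqP ->.
  rewrite /face_link eqxx /kasteleyn_bit; case: (e) ne => [[x y] []];
  rewrite /= /delta /other_square /shift /= => /negbTE->; rewrite eqxx.
    by have -> : odd (absz (2 * x - 0)%R) = false by lia.
  have -> : odd (absz (2 * x + 1)%R) = true by lia.
  by have -> : odd (absz (2 * y - 0)%R) = false by lia.
rewrite /face_link ne /kasteleyn_bit; case: (e) ne => [[x y] []];
rewrite /= /delta /other_square /shift /= eq_sym => /negbTE->; rewrite eqxx.
  by have -> : odd (absz (2 * x - 1)%R) = true by lia.
have -> : odd (absz (2 * x + 1)%R) = true by lia.
by have -> : odd (absz (2 * y - 1)%R) = true by lia.
Qed.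

Lemma vert_pos_inj : injective vert_pos.
Proof. by case=> x y [x' y'] [] /= h1 h2; congr (_, _); lia. Qed.

Lemma face_pos_inj : injective face_pos.
Proof. by case=> x y [x' y'] [] /= h1 h2; congr (_, _); lia. Qed.

Lemma edge_pos_inj : injective edge_pos.
Proof.
case=> [[x y] w] [[x' y'] w']; rewrite /edge_pos /=.
by case: w; case: w' => -[] /= h1 h2;
  [congr (_, _, _) | exfalso | exfalso | congr (_, _, _)]; lia.
Qed.

Lemma vert_face_pos v s : vert_pos v != face_pos s.
Proof. by rewrite xpair_eqE /=; lia. Qed.

Lemma edge_vert_pos e v : edge_pos e != vert_pos v.
Proof. by case: e => [[x y] []]; rewrite /edge_pos /vert_pos xpair_eqE /=;
  lia. Qed.

Lemma edge_face_pos e s : edge_pos e != face_pos s.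
Proof. by case: e => [[x y] []]; rewrite /edge_pos /face_pos xpair_eqE /=;
  lia. Qed.

Variant fine_spec : point -> Type :=
  | FineVert v : fine_spec (vert_pos v)
  | FineFace s : fine_spec (face_pos s)
  | FineEdge e : fine_spec (edge_pos e).

Lemma fineP p : fine_spec p.
Proof.
have half (x : int) : {x' | x = 2 * x'} + {x' | x = 2 * x' + 1}.
  by case: (boolP (odd (absz x))) => ox; [right | left]; exists (x %/ 2)%Z; lia.
case: p => x y; case: (half x) (half y) => [] [x' ->] [] [y' ->].
- exact: (FineVert (x', y')).
- exact: (FineEdge (x', y', true)).
- exact: (FineEdge (x', y', false)).
- exact: (FineFace (x', y')).
Qed.

(** A square of the refined lattice has one vertex, one face and two edges as corners; this and the
    next lemmas let a value of [h] pass from one kind of site to another through a common fine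
    square. *)
Lemma corner_quad v s : v \in corners s ->
  exists2 q, q \in squares_at (vert_pos v) & q \in squares_at (face_pos s).
Proof.
case: s => sx sy; rewrite !inE => /or4P[] /eqP ->;
[exists (2 * sx, 2 * sy) | exists (2 * sx + 1, 2 * sy)
| exists (2 * sx + 1, 2 * sy + 1) | exists (2 * sx, 2 * sy + 1)];
by rewrite !inE /shift /vert_pos /face_pos /= !xpair_eqE; lia.
Qed.

Lemma side_quad e s : e \in sides s ->
  exists2 q, q \in squares_at (edge_pos e) & q \in squares_at (face_pos s).
Proof.
case: s => sx sy; rewrite !inE => /or4P[] /eqP ->;
[exists (2 * sx, 2 * sy) | exists (2 * sx, 2 * sy + 1)
| exists (2 * sx, 2 * sy) | exists (2 * sx + 1, 2 * sy)];
by rewrite !inE /shift /edge_pos /face_pos /= !xpair_eqE; lia.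
Qed.

Lemma quads_at_vert v q : q \in squares_at (vert_pos v) ->
  exists2 s, v \in corners s & q \in squares_at (face_pos s).
Proof.
case: v => x y; rewrite /squares_at /shift /= => q_at.
have : q \in [:: (2 * x, 2 * y); (2 * x + -1, 2 * y + 0);
  (2 * x + -1, 2 * y + -1);
         (2 * x + 0, 2 * y + -1)] by exact: q_at.
rewrite !inE => /or4P[] /eqP ->; 
[exists (x, y) | exists (x - 1, y) | exists (x - 1, y - 1) | exists (x, y - 1)];
by rewrite !inE /shift /face_pos /= !xpair_eqE; lia.
Qed.

Lemma quads_at_edge e q : q \in squares_at (edge_pos e) ->
  exists2 s, e \in sides s & q \in squares_at (face_pos s).
Proof.
case: e => [[x y] w] q_at.
have {q_at}[|] : q \in squares_at (face_pos (x, y)) \/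
                 q \in squares_at (face_pos (other_square (x, y, w))).
  move: q_at; case: q => q1 q2; rewrite /other_square /face_pos /edge_pos.
  case: w; rewrite !inE /shift /= !xpair_eqE; lia.
- by exists (x, y); rewrite // mem_sides eqxx.
- by exists (other_square (x, y, w)); rewrite // mem_sides eqxx orbT.
Qed.

(** * The bordered Kasteleyn matrix *)

Lemma facesP (G : lattice_graph) s :
  reflect {subset sides s <= edges G} (s \in faces G).
Proof.
rewrite !inE /=; apply: (iffP andP) => [[_ /and5P[h1 h2 h3 h4 _]] e|sE].
  by rewrite !inE => /or4P[] /eqP->.
split; last by rewrite !sE ?inE ?eqxx ?orbT.
by apply: (edges_ends (sE (s, false) _)); rewrite ?mem_head.
Qed.

Lemma cross_not_face (G : lattice_graph) s s' :
  cross G s s' -> s \notin faces G /\ s' \notin faces G.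
Proof. by case=> e [/negP eE es es']; split; apply/facesP => sE; apply: eE;
  apply: sE. Qed.

(** All sides of a face are edges, so no crossing leaves it and nothing far away is reached. *)
Lemma outer_not_face (G : lattice_graph) s : outer_square G s -> s \notin faces
    G.
Proof.
move=> out; apply/negP => sF; have [s' ss'] := out (absz s.1 + absz s.2)%N.
suff -> : s' = s by rewrite ltnn.
elim: ss' sF => {s s' out} // [s s' /cross_not_face[/negP] //|].
by move=> s s' s'' _ IH1 _ IH2 sF; rewrite IH2 ?IH1.
Qed.

(** The hypothesis on bounded faces yields only the double negation of [outer_square s] for a square
    outside [faces]; this suffices because equality in [R] is decidable. The value is then carried
    along a path to a far square. *)
Lemma cross_invariant_outer (G : lattice_graph) (R : eqType) (h : point -> R)
    (z : R) :
    bounded_faces_are_squares G ->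
    (exists N, forall s, far N s -> h s = z) ->
    (forall s s', cross G s s' -> h s = h s') ->
  forall s, s \notin faces G -> h s = z.
Proof.
move=> hfaces [N hN] hcross s sN; apply/eqP/negPn/negP => hs.
case/facesP: sN; apply: hfaces => out.
have [s' ss' far_s'] := out N.*2.
case/eqP: hs; rewrite -(hN s'); last by rewrite /far; lia.
by elim: ss' {out hN far_s'} => // s1 s2 s3 _ -> _ ->.
Qed.

Section Rows.
Variables (G : lattice_graph) (n k : nat).
Variables (t : 'I_n -> faces G) (f : 'I_n -> ledge).
Variables (a : 'I_k -> faces G) (b : 'I_k -> verts G).

Definition gk_col : finType := ((faces G + 'I_n) + verts G)%type.
Definition gk_row : finType := (edges G + ('I_k + 'I_k))%type.

(* The Kasteleyn matrix has a row for each vertex [m_e], and is bordered by two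
   unit rows for each impurity, which force its two ends out of the matching
   of the [m_e]; in this way no column has to be deleted.  The two ends of an
   impurity need not be distinct from those of another one: the determinant is
   then zero. *)
Definition row_arc (r : gk_row) (c : gk_col) : bool :=
  match r, c with
  | inl e, inl (inl s) => val e \in sides (val s)
  | inl e, inl (inr i) => val e == f i
  | inl e, inr v => val v \in ends (val e)
  | inr (inl j), inl (inl s) => s == a j
  | inr (inr j), inr v => v == b j
  | _, _ => false
  end.

(** A terminal column borrows the sign of the face carrying the terminal, so that the two signs at
    [f i] multiply to 1 in [flow_col_face_term]. *)
Definition row_bit (r : gk_row) (c : gk_col) : bool :=
  match r, c with
  | inl e, inl (inl s) => kasteleyn_bit (face_link (val e) (val s))
  | inl e, inl (inr i) => kasteleyn_bit (face_link (val e) (val (t i)))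
  | inl e, inr v => kasteleyn_bit (vert_link (val e) (val v))
  | _, _ => false
  end.

Definition row_entry (r : gk_row) (c : gk_col) : int :=
  if row_arc r c then (-1) ^+ row_bit r c else 0.

(* A terminal has no place in the refined lattice, where two of them could fall
   in the same square; its column plays no role in cycles anyway, having a
   single nonzero entry. *)
Definition is_edge (r : gk_row) : bool := if r is inl _ then true else false.
Definition is_site (c : gk_col) : bool :=
  match c with inl (inr _) => false | _ => true end.

Definition row_pos (r : gk_row) : point :=
  if r is inl e then edge_pos (val e) else (0, 0).
Definition col_pos (c : gk_col) : point :=
  match c with
  | inl (inl s) => face_pos (val s)
  | inl (inr _) => (0, 0)
  | inr v => vert_pos (val v)
  end.
Definition row_link (r : gk_row) (c : gk_col) : ledge :=
  match r, c with
  | inl e, inl (inl s) => face_link (val e) (val s)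
  | inl e, inr v => vert_link (val e) (val v)
  | _, _ => ((0, 0), false)
  end.

Lemma row_arc_extra r c c' :
  ~~ is_edge r -> row_arc r c -> row_arc r c' -> c = c'.
Proof.
by case: r => [//|[] j] _; case: c => [[s|i]|v]; case: c' => [[s'|i']|v'] //=
   /eqP-> /eqP->.
Qed.

Lemma row_arc_term r r' c :
  ~~ is_site c -> row_arc r c -> row_arc r' c -> r = r'.
Proof.
case: c => [[s|i]|v] // _; case: r => [e|[] j]; case: r' => [e'|[] j'] //=.
move=> /eqP he /eqP he'; congr inl; apply: val_inj; exact: etrans he (esym he').
Qed.

Lemma row_pos_inj r r' : is_edge r -> is_edge r' -> row_pos r = row_pos r' -> r
    = r'.
Proof.
by case: r => [e|//]; case: r' => [e'|//] _ _ /edge_pos_inj/val_inj ->.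
Qed.

Lemma col_pos_inj c c' : is_site c -> is_site c' -> col_pos c = col_pos c' -> c
    = c'.
Proof.
case: c => [[s|//]|v] _; case: c' => [[s'|//]|v'] _ /=.
- by move/face_pos_inj/val_inj->.
- by move/eqP; rewrite eq_sym (negbTE (vert_face_pos _ _)).
- by move/eqP; rewrite (negbTE (vert_face_pos _ _)).
- by move/vert_pos_inj/val_inj->.
Qed.

Lemma row_col_pos r c : is_edge r -> is_site c -> row_pos r != col_pos c.
Proof.
by case: r => [e|//] _; case: c => [[s|//]|v] _;
  rewrite /= ?edge_face_pos ?edge_vert_pos.
Qed.

Lemma ends_row_link r c : is_edge r -> is_site c -> row_arc r c ->
  ends (row_link r c) =i [:: row_pos r; col_pos c].
Proof.
case: r => [e|//] _; case: c => [[s|//]|v] _ /=.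
  exact: ends_face_link.
exact: ends_vert_link.
Qed.

Lemma row_bitE r c : is_edge r -> is_site c -> row_bit r c = kasteleyn_bit
    (row_link r c).
Proof. by case: r => [e|//]; case: c => [[s|//]|v]. Qed.

Hypothesis (hfaces : bounded_faces_are_squares G).
Hypothesis (hf : forall i, outer_edge G (f i)).
Hypothesis (hb : forall j, boundary2 (b j)).
Hypothesis (hab : forall j, val (b j) \in corners (val (a j))).

(** * All nonzero terms of the determinant have the same sign *)

Section Signs.
Variables (I : finType) (r : I -> gk_row) (c : I -> gk_col).
Hypotheses (r_bij : bijective r) (c_bij : bijective c).

Definition valid_perm (s : {perm I}) : bool := [forall i, row_arc (r i) (c (s
    i))].

Section TwoPerms.
Variables (s s' : {perm I}).
Hypotheses (s_valid : valid_perm s) (s'_valid : valid_perm s').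
Let pi : {perm I} := (s * s'^-1)%g.
Let Q : {pred I} := [pred i | is_edge (r i) && is_site (c (s i))].
Let x i := row_pos (r i).
Let y i := col_pos (c (s i)).

Lemma s'_pi i : s' (pi i) = s i.
Proof. by rewrite permM permKV. Qed.

Lemma arc_s i : row_arc (r i) (c (s i)).
Proof. exact: (forallP s_valid). Qed.

Lemma arc_pi i : row_arc (r (pi i)) (c (s i)).
Proof. by rewrite -s'_pi; apply: (forallP s'_valid). Qed.

(** A unit row and a terminal column each admit a single arc, so the two permutations agree
    there. *)
Lemma pi_fix i : i \notin Q -> pi i = i.
Proof.
rewrite negb_and => /orP[edgeN|siteN].
  have : c (s i) = c (s' i).
    apply: row_arc_extra edgeN _ _; first exact: arc_s.
    exact: (forallP s'_valid).
  by move/(bij_inj c_bij); rewrite permM => ->; rewrite permK.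
exact: (bij_inj r_bij) (row_arc_term siteN (arc_pi i) (arc_s i)).
Qed.

Lemma Q_pi i : i \in Q -> pi i \in Q.
Proof.
have [-> //|ne_i iQ] := eqVneq (pi i) i.
apply: contraR ne_i => /pi_fix /perm_inj -> //.
Qed.

Lemma matched_face (u : faces G) :
  (forall j, u != a j) -> matched Q x y (face_pos (val u)).
Proof.
move=> uN; have [c' _ cK] := c_bij; pose i := (s^-1)%g (c' (inl (inl u))).
have ci : c (s i) = inl (inl u) by rewrite permKV cK.
apply/existsP; exists i; rewrite inE /y ci eqxx orbT !andbT.
have := arc_s i; rewrite ci; case: (r i) => [//|[] j //=].
by rewrite (negbTE (uN j)).
Qed.

Lemma matched_vert (u : verts G) :
  (forall j, u != b j) -> matched Q x y (vert_pos (val u)).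
Proof.
move=> uN; have [c' _ cK] := c_bij; pose i := (s^-1)%g (c' (inr u)).
have ci : c (s i) = inr u by rewrite permKV cK.
apply/existsP; exists i; rewrite inE /y ci eqxx orbT !andbT.
have := arc_s i; rewrite ci; case: (r i) => [//|[] j //=].
by rewrite (negbTE (uN j)).
Qed.

Lemma matched_edge (e : edges G) :
  (forall i, val e != f i) -> matched Q x y (edge_pos (val e)).
Proof.
move=> eN; have [r' _ rK] := r_bij; pose i := r' (inl e).
have ri : r i = inl e by rewrite rK.
apply/existsP; exists i; rewrite inE /x ri eqxx !andbT /=.
have := arc_s i; rewrite ri; case: (c (s i)) => [[//|i']|//] /=.
by rewrite (negbTE (eN i')).
Qed.

Lemma site_edge i e : r i = inl e -> is_site (c (s i)) -> forall l, val e != f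
    l.
Proof.
move=> ri ci l; apply/eqP => el; have [c' _ cK] := c_bij.
pose i' := (s^-1)%g (c' (inl (inr l))).
have ci' : c (s i') = inl (inr l) by rewrite permKV cK.
have := row_arc_term (c := inl (inr l)) (r := inl e) (r' := r i') isT.
rewrite /= el eqxx -ci' => /(_ isT (arc_s i'));
  rewrite -ri => /(bij_inj r_bij) eq_i.
by rewrite eq_i ci' in ci.
Qed.

Lemma matched_pos p : matched Q x y p ->
  [\/ exists u : faces G, p = face_pos (val u),
      exists2 u : verts G, p = vert_pos (val u) & forall j, u != b j
    | exists2 e : edges G, p = edge_pos (val e) & forall i, val e != f i].
Proof.
case/existsP=> i /andP[/andP[]]; rewrite /x /y.
have := arc_s i.
case ri: (r i) => [e|//]; case ci: (c (s i)) => [[u|//]|v] /= arc_i _ _.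
  case/orP=> /eqP eq_p; last by apply: Or31; exists u.
  by apply: Or33; exists e => //; apply: (site_edge ri); rewrite ci.
case/orP=> /eqP eq_p; first by apply: Or33; exists e => //;
  apply: (site_edge ri); rewrite ci.
apply: Or32; exists v => // j.
apply/eqP => vb; have [r' _ rK] := r_bij; pose i' := r' (inr (inr j)).
have ri' : r i' = inr (inr j) by rewrite rK.
have := row_arc_extra (r := r i') (c := c (s i')) (c' := c (s i)).
rewrite arc_s ri' ci /= vb eqxx => /(_ isT isT isT); rewrite -vb -ci.
by move=> /(bij_inj c_bij)/perm_inj eq_i; rewrite eq_i ri in ri'.
Qed.

(** No boundary edge of [h] ends at an unmatched point, so [h] is constant around it. The value 0
    thus spreads from far away through the outer face, then to the points of the [b j] and the
    [f i], and from [b j] to [a j], which has it as a corner. Hence no unmatched point touches the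
    support of [h]. *)
Lemma inside_matched_sites (h : point -> bool) : fin_chain2 h ->
  (forall e, boundary h e -> {in ends e, forall p, matched Q x y p}) ->
  forall q, h q -> {in corners q, forall p, matched Q x y p}.
Proof.
case=> N hN hE q hq p pq; apply: contraLR hq => pN.
have around p' : ~~ matched Q x y p' -> {in squares_at p', forall q, h q = h
  p'}.
  move=> p'N; apply: constant_around => e p'e; apply: contraNF p'N => /hE.
  by apply.
have zero_at p' q' : ~~ matched Q x y p' -> q' \in squares_at p' -> h q' =
  false ->
    {in squares_at p', forall q, h q = false}.
  by move=> /around hp' q'p' hq' q'' /hp' ->; rewrite -(hp' q').
(* Centres of squares that are not faces, and midpoints of lattice edges missing from [G], are
   unmatched, so [h] is invariant under [cross]. *)
have not_face s0 : s0 \notin faces G -> {in squares_at (face_pos s0), forall q,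
  h q = false}.
  have faceN s1 : s1 \notin faces G -> ~~ matched Q x y (face_pos s1).
    move=> s1N; apply/negP => /matched_pos[[u /face_pos_inj eq_s]|[u /eqP]|[e
      /eqP]].
    - by rewrite eq_s (valP u) in s1N.
    - by rewrite eq_sym (negbTE (vert_face_pos _ _)).
    - by rewrite eq_sym (negbTE (edge_face_pos _ _)).
  move=> s0N q' /(around _ (faceN _ s0N)) ->.
  apply: (@cross_invariant_outer G _ (fun s1 => h (face_pos s1)) false) => //.
    by exists N => s1 far_s1; apply: hN; move: far_s1; rewrite /far /=; lia.
  move=> s1 s2 /[dup] /cross_not_face[/faceN n1 /faceN n2] [e [eN es1 es2]].
  have eM : ~~ matched Q x y (edge_pos e).
    apply/negP => /matched_pos[[u /eqP]|[u /eqP]|[e' /edge_pos_inj eq_e]].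
    - by rewrite (negbTE (edge_face_pos _ _)).
    - by rewrite (negbTE (edge_vert_pos _ _)).
    - by rewrite eq_e (valP e') in eN.
  have [q1 q1e q1s] := side_quad es1; have [q2 q2e q2s] := side_quad es2.
  rewrite -(around _ n1 _ q1s) -(around _ n2 _ q2s).
  by rewrite (around _ eM _ q1e) (around _ eM _ q2e).
(* [b j] ends an outer edge, hence shares a fine square with the centre of an outer square. *)
have b_zero j : {in squares_at (vert_pos (val (b j))), forall q, h q = false}.
  have [e [eE [s0 es0 /outer_not_face s0N]] be] := hb j.
  have [q' q'v q's] := corner_quad (ends_corners es0 be).
  apply: zero_at q'v (not_face _ s0N _ q's); apply/negP.
  case/matched_pos=> [[u /eqP]|[u /vert_pos_inj/val_inj <- /(_ j)]|[e' /eqP]].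
  - by rewrite (negbTE (vert_face_pos _ _)).
  - by rewrite eqxx.
  - by rewrite eq_sym (negbTE (edge_vert_pos _ _)).
suff zero_p : {in squares_at p, forall q, h q = false}.
  by rewrite zero_p // -mem_corners_at.
move: pN; clear pq; case: (fineP p) => [v|u|e] pN.
- have [vV|vN] := boolP (v \in verts G).
    have [/existsP[j /eqP eq_v]|/existsPn vb] := boolP [exists j, [` vV]%fset
      == b j].
      by move=> q'; have := b_zero j q'; rewrite -eq_v.
    by rewrite (matched_vert vb) in pN.
  move=> q' /quads_at_vert[s0 v_s0]; apply: not_face; apply/facesP => s0E.
  case/negP: vN; move: v_s0; rewrite !inE.
  have s_e e : e \in sides s0 -> {subset ends e <= verts G}.
    by move/s0E; apply: edges_ends.
  case/or4P=> /eqP->.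
  + by apply: (s_e (s0, false)); rewrite ?mem_head.
  + by apply: (s_e (s0, false)); rewrite ?mem_head // !inE eqxx orbT.
  + apply: (s_e (shift s0 0 1, false)); rewrite !inE ?eqxx ?orbT //=.
    by rewrite /shift /= !xpair_eqE; lia.
  + by apply: (s_e (shift s0 0 1, false)); rewrite ?mem_head // !inE eqxx ?orbT.
- have [uF|uN] := boolP (u \in faces G); last exact: not_face.
  have [/existsP[j /eqP eq_u]|/existsPn ua] := boolP [exists j, [` uF]%fset ==
    a j].
    have [q' q'v q'u] := corner_quad (hab j); rewrite -eq_u in q'u.
    exact: zero_at pN q'u (b_zero _ _ q'v).
  by rewrite (matched_face ua) in pN.
- have [eE|eN] := boolP (e \in edges G); last first.
    move=> q' /quads_at_edge[s0 e_s0]; apply: not_face; apply/facesP => s0E.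
    by rewrite s0E in eN.
  have [/existsP[i /eqP eq_e]|/existsPn ef] := boolP [exists i, e == f i].
    have [_ [s0 es0 /outer_not_face s0N]] := hf i; rewrite -eq_e in es0.
    have [q' q'e q's] := side_quad es0.
    exact: zero_at pN q'e (not_face _ s0N _ q's).
  by rewrite (matched_edge (e := [` eE]%fset) ef) in pN.
Qed.

(** Since [s' (pi i) = s i], the links of [s] and [s'] at the column of [s i] are the edges [a i]
    and [b i] of [kasteleyn]; indices outside [Q] are fixed and contribute equal bits. *)
Lemma sign_coherent :
  s (+) (\sum_i row_bit (r i) (c (s i)) : bool) =
  s' (+) (\sum_i row_bit (r i) (c (s' i)) : bool).
Proof.
have edgeQ i : i \in Q -> is_edge (r i) by case/andP.
have siteQ i : i \in Q -> is_site (c (s i)) by case/andP.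
have : \sum_(i in Q) (kasteleyn_bit (row_link (r i) (c (s i)))
    + kasteleyn_bit (row_link (r (pi i)) (c (s i)))) = odd_perm pi :> bool.
  apply: (@kasteleyn _ pi Q x y); first exact: Q_pi.
  - exact: pi_fix.
  - move=> i j iQ jQ /row_pos_inj eq_ij; apply: (bij_inj r_bij).
    by apply: eq_ij; apply: edgeQ.
  - move=> i j iQ jQ /col_pos_inj eq_ij; apply: (@perm_inj _ s);
      apply: (bij_inj c_bij).
    by apply: eq_ij; apply: siteQ.
  - by move=> i j iQ jQ; apply: row_col_pos; [apply: edgeQ | apply: siteQ].
  - by move=> i iQ; apply: ends_row_link; rewrite ?edgeQ ?siteQ ?arc_s.
  - by move=> i iQ; apply: ends_row_link; rewrite ?edgeQ ?siteQ ?arc_pi ?Q_pi.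
  - exact: inside_matched_sites.
rewrite odd_permM odd_permV => sumQ.
have -> : \sum_i row_bit (r i) (c (s' i)) = \sum_i row_bit (r (pi i)) (c (s i))
  :> bool.
  by rewrite (reindex_inj (@perm_inj _ pi)); apply: eq_bigr => i _;
    rewrite s'_pi.
have : \sum_i (row_bit (r i) (c (s i)) + row_bit (r (pi i)) (c (s i))) = (s (+)
  s') :> bool.
  rewrite -sumQ [RHS]big_mkcond; apply: eq_bigr => i _.
  case: ifP => [iQ|/negbT/pi_fix ->]; last by case: row_bit.
  by rewrite !row_bitE ?edgeQ ?siteQ ?Q_pi.
rewrite big_split /=.
set A := \sum_i _; set B := \sum_i _.
by case: A B (odd_perm s) (odd_perm s') => [] [] [] [].
Qed.

End TwoPerms.

End Signs.
End Rows.

(** * Counting matchings by a determinant *)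

Lemma abs_det_count (G : lattice_graph) (n k : nat)
    (t : 'I_n -> faces G) (f : 'I_n -> ledge)
    (a : 'I_k -> faces G) (b : 'I_k -> verts G)
    (m : nat) (r : 'I_m -> gk_row G k) (c : 'I_m -> gk_col G n) :
    bounded_faces_are_squares G ->
    (forall i, outer_edge G (f i)) -> (forall j, boundary2 (b j)) ->
    (forall j, val (b j) \in corners (val (a j))) ->
    bijective r -> bijective c ->
  `|\det (\matrix_(i, j) row_entry t f a b (r i) (c j))| =
    #|[set s | valid_perm f a b r c s]|%:Z.
Proof.
move=> hfaces hf hb hab r_bij c_bij; set A := [set s | _].
have termE (s : 'S_m) : (-1) ^+ s * \prod_i (\matrix_(i, j) row_entry t f a b
  (r i) (c j)) i (s i)
   = if s \in A then (-1) ^+ (s (+) \sum_i row_bit t (r i) (c (s i)) : bool)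
     else 0 :> int.
  under eq_bigr do rewrite mxE.
  rewrite inE; have [/forallP s_valid|/forallPn[i arcN]] := boolP (valid_perm _
    _ _ _ _ _).
    rewrite signr_addb; congr (_ * _).
    have signD : {morph (fun x : bool => (-1) ^+ x : int) : x y / x + y >-> x *
      y}.
      by move=> x y; apply: signr_addb.
    rewrite (big_morph _ signD (erefl : (-1) ^+ false = 1 :> int)).
    by apply: eq_bigr => i _; rewrite /row_entry s_valid.
  by rewrite (bigD1 i) //= /row_entry (negbTE arcN) mul0r mulr0.
rewrite /determinant (eq_bigr _ (fun s _ => termE s)) -big_mkcond.
have [->|[s0 s0A]] := set_0Vmem A; first by rewrite big_set0 cards0 normr0.
rewrite (eq_bigr (fun _ => (-1) ^+ (s0 (+) \sum_i row_bit t (r i) (c (s0 i)) :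
  bool))).
  by rewrite sumr_const normrMn normr_sign natz.
move=> s; rewrite inE => s_valid; rewrite inE in s0A.
by congr ((-1) ^+ (nat_of_bool _)); apply: sign_coherent.
Qed.

(** * Perfect matchings as permutations of the bordered matrix *)

Section Matchings.
Variables (G : lattice_graph) (n k : nat) (f : 'I_n -> ledge).
Variables (a : 'I_k -> faces G) (b : 'I_k -> verts G).

Definition col_vertex (c : gk_col G n) : gk_vertex G n :=
  match c with inl u => inl u | inr v => vertex_vert n v end.

Local Notation edge_pair e c := [set vertex_edge n e; col_vertex c].
Local Notation impurity_pair j := [set vertex_face n (a j);
  vertex_vert n (b j)].

Lemma col_vertex_inj : injective col_vertex.
Proof. by case=> [u|v] [u'|v'] //= [->]. Qed.

Lemma edge_vertex_neq e c : (vertex_edge n e == col_vertex c) = false.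
Proof. by case: c. Qed.

Lemma edge_in_pair e e' c : (vertex_edge n e \in edge_pair e' c) = (e == e').
Proof. by rewrite !inE edge_vertex_neq orbF. Qed.

Lemma col_in_pair e c c' : (col_vertex c \in edge_pair e c') = (c == c').
Proof. by rewrite !inE eq_sym edge_vertex_neq /= (inj_eq col_vertex_inj). Qed.

Lemma edge_in_impurity e u v :
  vertex_edge n e \in [set (inl u : gk_vertex G n); vertex_vert n v] = false.
Proof. by rewrite !inE. Qed.

Lemma row_arc_edge e c :
  row_arc f a b (inl e) c = gk_arc f (vertex_edge n e) (col_vertex c).
Proof. by case: c => [[s|i]|v]. Qed.

Lemma gk_adj_cases u w : gk_adj f u w ->
  (exists e c, [set u; w] = edge_pair e c /\ row_arc f a b (inl e) c) \/
  (exists x v, [set u; w] = [set (inl x : gk_vertex G n); vertex_vert n v]).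
Proof.
have arc u' w' : gk_arc f u' w' ->
    (exists e c, [set u'; w'] = edge_pair e c /\ row_arc f a b (inl e) c) \/
    (exists x v, [set u'; w'] = [set (inl x : gk_vertex G n); vertex_vert n v]).
  case: u' => [[s|i]|[v|e]]; case: w' => [[s'|i']|[v'|e']] //= hc.
  - by right; exists (inl s), v'.
  - by right; exists (inr i), v'.
  - by left; exists e, (inl (inl s')).
  - by left; exists e, (inl (inr i')).
  - by left; exists e, (inr v').
by case/orP=> /arc //; rewrite setUC.
Qed.

Section Perms.
Variables (I : finType) (r : I -> gk_row G k) (c : I -> gk_col G n).
Variables (r' : gk_row G k -> I) (c' : gk_col G n -> I).
Hypotheses (rK : cancel r r') (r'K : cancel r' r) (cK : cancel c c') (c'K :
  cancel c' c).
Hypothesis hab : forall j, val (b j) \in corners (val (a j)).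

Definition impurity_set : {set {set gk_vertex G n}} := [set impurity_pair j | j
    : 'I_k].

Definition edge_col (s : {perm I}) (e : edges G) : gk_col G n := c (s (r' (inl
    e))).

(** The edge rows give the pairs with a vertex [m_e]; the two unit rows of an impurity, which hold
    its ends, are traded for the edge joining these ends. *)
Definition matching_of (s : {perm I}) : {set {set gk_vertex G n}} :=
  [set edge_pair e (edge_col s e) | e : edges G] :|: impurity_set.

Lemma matching_of_cases s X : X \in matching_of s ->
  (exists e, X = edge_pair e (edge_col s e)) \/ (exists j, X = impurity_pair j).
Proof. by case/setUP=> /imsetP[x _ ->]; [left|right]; exists x. Qed.

Lemma mem_matching_edge s e : edge_pair e (edge_col s e) \in matching_of s.
Proof. by apply/setUP; left; apply: imset_f. Qed.

Lemma mem_matching_impurity s j : impurity_pair j \in matching_of s.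
Proof. by apply/setUP; right; apply: imset_f. Qed.

Lemma edge_col_inj s : injective (edge_col s).
Proof.
move=> e e' /(can_inj cK)/perm_inj/(can_inj r'K) []; done.
Qed.

Lemma valid_face s j : valid_perm f a b r c s -> c (s (r' (inr (inl j)))) = inl
    (inl (a j)).
Proof.
move/forallP/(_ (r' (inr (inl j)))); rewrite r'K.
by case: (c _) => [[u|i]|v] //= /eqP ->.
Qed.

Lemma valid_vert s j : valid_perm f a b r c s -> c (s (r' (inr (inr j)))) = inr
    (b j).
Proof.
move/forallP/(_ (r' (inr (inr j)))); rewrite r'K.
by case: (c _) => [[u|i]|v] //= /eqP ->.
Qed.

Lemma valid_col (s : {perm I}) (r0 : gk_row G k) (i : I) : c (s i) = c (s (r'
    r0)) -> r i = r0.
Proof. by move=> /(can_inj cK)/perm_inj ->; rewrite r'K. Qed.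

Lemma matching_of_perfect s :
  valid_perm f a b r c s -> perfect_matching (gk_adj f) (matching_of s).
Proof.
move=> s_valid; apply/andP; split.
  apply/forallP => X; apply/implyP => /matching_of_cases[[e ->]|[j ->]].
    apply/existsP; exists (vertex_edge n e); apply/existsP;
      exists (col_vertex (edge_col s e)).
    rewrite eqxx andbT /gk_adj -row_arc_edge.
    by have /forallP/(_ (r' (inl e))) := s_valid; rewrite r'K => ->.
  apply/existsP; exists (vertex_face n (a j)); apply/existsP;
    exists (vertex_vert n (b j)).
  by rewrite eqxx andbT /gk_adj /= hab.
apply/forallP => u; apply/cards1P.
have uniq_edge X : X \in matching_of s -> u \in X ->
   (forall Y, Y \in matching_of s -> u \in Y -> Y = X) ->
   exists x, [set e in matching_of s | u \in e] = [set x].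
  move=> XM uX X_uniq; exists X; apply/setP => Y.
  by apply/setIdP/set1P => [[YM uY]|->]; [apply: X_uniq | split].
(* The row sent by [s] to [c0] tells how [c0] is covered: an edge row by its pair, a unit row by its
   impurity. *)
have col_case c0 : u = col_vertex c0 -> exists x, [set e in matching_of s | u
  \in e] = [set x].
  move=> uc; pose i := (s^-1)%g (c' c0);
    have ci : c (s i) = c0 by rewrite permKV c'K.
  have := forallP s_valid i; case ri: (r i) => [e|[] j]; rewrite ci.
  - move=> _; have e_c0 : edge_col s e = c0 by rewrite /edge_col -ri rK.
    apply: (uniq_edge (edge_pair e c0));
      first by rewrite -e_c0 mem_matching_edge.
      by rewrite uc !inE eqxx orbT.
    move=> Y /matching_of_cases[[e' ->]|[j ->]]; rewrite uc.
      by rewrite col_in_pair -{1}e_c0 => /eqP/edge_col_inj <-; rewrite e_c0.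
    rewrite !inE => /orP[] /eqP eq_c0.
      have := valid_face j s_valid; have -> : inl (inl (a j)) = c0.
        by apply: col_vertex_inj; rewrite eq_c0.
      by rewrite -ci => /esym/valid_col; rewrite ri.
    have := valid_vert j s_valid; have -> : inr (b j) = c0.
      by apply: col_vertex_inj; rewrite eq_c0.
    by rewrite -ci => /esym/valid_col; rewrite ri.
  - move=> arc0; have c0E : c0 = inl (inl (a j)).
      by case: (c0) arc0 => [[v|l]|v] //= /eqP ->.
    apply: (uniq_edge (impurity_pair j)); first exact: mem_matching_impurity.
      by rewrite uc c0E !inE eqxx.
    move=> Y /matching_of_cases[[e ->]|[j' ->]]; rewrite uc.
      by rewrite col_in_pair -ci => /eqP/valid_col; rewrite ri.
    rewrite c0E !inE orbF => /eqP [a_j].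
    have := valid_face j' s_valid; rewrite -a_j -c0E -ci => /esym/valid_col.
    by rewrite ri => -[->].
  - move=> arc0; have c0E : c0 = inr (b j).
      by case: (c0) arc0 => [[v|l]|v] //= /eqP ->.
    apply: (uniq_edge (impurity_pair j)); first exact: mem_matching_impurity.
      by rewrite uc c0E !inE eqxx orbT.
    move=> Y /matching_of_cases[[e ->]|[j' ->]]; rewrite uc.
      by rewrite col_in_pair -ci => /eqP/valid_col; rewrite ri.
    rewrite c0E !inE => /eqP [b_j].
    have := valid_vert j' s_valid; rewrite -b_j -c0E -ci => /esym/valid_col.
    by rewrite ri => -[->].
case: u uniq_edge col_case => [u|[v|e]] uniq_edge col_case.
- exact: (col_case (inl u)).
- exact: (col_case (inr v)).
- apply: (uniq_edge _ (mem_matching_edge s e)); first by rewrite !inE eqxx.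
  move=> Y /matching_of_cases[[e' ->]|[j ->]]; last by rewrite edge_in_impurity.
  by rewrite edge_in_pair => /eqP ->.
Qed.

Lemma matching_of_impurities s : impurities (matching_of s) = impurity_set.
Proof.
apply/setP => X; rewrite inE;
  apply/andP/idP => [[/matching_of_cases[[e ->]|[j ->]]]|].
- case/existsP=> u /existsP[v /eqP/setP/(_ (vertex_edge n e))].
  by rewrite edge_in_impurity edge_in_pair eqxx.
- by move=> _; apply: imset_f.
- move=> X_imp; split; first by rewrite inE X_imp orbT.
  case/imsetP: X_imp => j _ ->; apply/existsP; exists (inl (a j)).
  by apply/existsP; exists (b j).
Qed.

Lemma matching_of_inj : {in [set s | valid_perm f a b r c s] &, injective
    matching_of}.
Proof.
move=> s1 s2; rewrite !inE => v1 v2 eqM; apply/permP => i; apply: (can_inj cK).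
case ri: (r i) => [e|x].
  have := mem_matching_edge s1 e;
    rewrite eqM => /matching_of_cases[[e' eqX]|[j eqX]].
    have := edge_in_pair e e (edge_col s1 e).
    rewrite {1}eqX edge_in_pair eqxx => /eqP e_e'.
    have : col_vertex (edge_col s1 e) \in edge_pair e' (edge_col s2 e').
      by rewrite -eqX col_in_pair.
    by rewrite col_in_pair -e_e' /edge_col -ri rK => /eqP.
  by have := edge_in_pair e e (edge_col s1 e);
    rewrite {1}eqX edge_in_impurity eqxx.
have := row_arc_extra (r := r i) (c := c (s1 i)) (c' := c (s2 i)) (f := f) (a
  := a) (b := b).
by apply; [rewrite ri | apply: (forallP v1) | apply: (forallP v2)].
Qed.

(** An edge of the graph either contains some [m_e] or is an impurity by definition, so [M] is
    determined by the partners of the [m_e] and the prescribed impurities. *)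
Lemma matching_of_onto M : M \in matchings_with_impurities f a b ->
  exists2 s, valid_perm f a b r c s & M = matching_of s.
Proof.
rewrite inE => /andP[/andP[/forallP M_adj /forallP M_cover] /eqP M_imp].
have cover u : exists2 X, X \in M & u \in X.
  have /cards1P[X eqX] := M_cover u; have : X \in [set X] by rewrite inE.
  by rewrite -eqX inE => /andP[]; exists X.
have cover_uniq u X Y : X \in M -> Y \in M -> u \in X -> u \in Y -> X = Y.
  move=> XM YM uX uY; have /cards1P[Z eqZ] := M_cover u.
  have in_Z W : W \in M -> u \in W -> W = Z.
    by move=> WM uW; apply/set1P; rewrite -eqZ inE WM.
  by rewrite (in_Z X) // (in_Z Y).
have M_cases X : X \in M -> 
   (exists e c0, X = edge_pair e c0 /\ row_arc f a b (inl e) c0) \/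
   (exists j, X = impurity_pair j).
  move=> XM; have /implyP/(_ XM)/existsP[u /existsP[v /andP[uv /eqP X_uv]]] :=
    M_adj X.
  have [|[x [w eqX]]] := gk_adj_cases uv; first by rewrite -X_uv; left.
  right; have : X \in impurities M.
    rewrite inE XM X_uv eqX; apply/existsP; exists x; apply/existsP; exists w;
      exact: eqxx.
  by rewrite M_imp => /imsetP[j _ ->]; exists j.
have partner e : {c0 | edge_pair e c0 \in M & row_arc f a b (inl e) c0}.
  suff : exists c0, (edge_pair e c0 \in M) && row_arc f a b (inl e) c0.
    by case/sigW=> c0 /andP[]; exists c0.
  have [X XM eX] := cover (vertex_edge n e).
  have [[e' [c0 [eqX arc_c0]]]|[j eqX]] := M_cases X XM; last first.
    by rewrite eqX edge_in_impurity in eX.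
  exists c0; move: eX; rewrite eqX edge_in_pair => /eqP ->.
  by rewrite arc_c0 -eqX XM.
pose g (r0 : gk_row G k) : gk_col G n := match r0 with
  | inl e => s2val (partner e) | inr (inl j) => inl (inl (a j)) | inr (inr j)
    => inr (b j) end.
have g_arc r0 : row_arc f a b r0 (g r0).
  by case: r0 => [e|[] j] /=; rewrite ?eqxx //; apply: (s2valP' (partner e)).
have g_edge e : edge_pair e (g (inl e)) \in M by apply: (s2valP (partner e)).
have g_onto c0 : exists r0, g r0 = c0.
  have [X XM cX] := cover (col_vertex c0).
  have [[e [c1 [eqX _]]]|[j eqX]] := M_cases X XM.
    move: cX; rewrite eqX col_in_pair => /eqP c01; exists (inl e).
    have eqX' : X = edge_pair e (g (inl e)).
      by apply: (cover_uniq (vertex_edge n e));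
        rewrite ?XM ?g_edge ?eqX ?edge_in_pair.
    have : col_vertex (g (inl e)) \in X by rewrite eqX' col_in_pair.
    by rewrite eqX col_in_pair c01 => /eqP.
  move: cX; rewrite eqX !inE => /orP[] /eqP c0E.
    by exists (inr (inl j)); apply: col_vertex_inj; rewrite c0E.
  by exists (inr (inr j)); apply: col_vertex_inj; rewrite c0E.
pose s_fun i := c' (g (r i)).
(* Rows and columns are indexed by the same finite [I], so covering every column is enough. *)
have s_inj : injective s_fun.
  apply/injectiveP/card_uniqP.
  suff s_onto i : i \in codom s_fun by rewrite (eq_card (B := I)) ?size_codom.
  have [r0 g0] := g_onto (c i); apply/codomP; exists (r' r0).
  by rewrite /s_fun r'K g0 cK.
pose s := perm s_inj.
have cs i : c (s i) = g (r i) by rewrite permE /s_fun c'K.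
have colE e : edge_col s e = g (inl e) by rewrite /edge_col cs r'K.
exists s; first by apply/forallP => i; rewrite cs.
apply/setP => X; apply/idP/idP.
  move=> XM; have [[e [c0 [eqX _]]]|[j ->]] := M_cases X XM;
    last exact: mem_matching_impurity.
  have -> : X = edge_pair e (edge_col s e); last exact: mem_matching_edge.
  by apply: (cover_uniq (vertex_edge n e));
    rewrite ?XM ?colE ?g_edge ?eqX ?edge_in_pair.
case/matching_of_cases=> [[e ->]|[j ->]]; first by rewrite colE.
have : impurity_pair j \in impurities M by rewrite M_imp; apply: imset_f.
by rewrite inE => /andP[].
Qed.

Lemma card_matchings :
  #|matchings_with_impurities f a b| = #|[set s | valid_perm f a b r c s]|.
Proof.
rewrite -(card_in_imset matching_of_inj); apply: eq_card => M.
apply/idP/imsetP => [/matching_of_onto[s s_valid ->]|[s]].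
  by exists s; rewrite ?inE.
rewrite inE => s_valid ->; rewrite inE matching_of_perfect //.
by rewrite matching_of_impurities eqxx.
Qed.

End Perms.
End Matchings.

(** * Chains on a lattice graph *)

Lemma divergence_fset_sum (R : comNzRingType) (A : {fset ledge}) (c : ledge ->
    R) p :
  (forall e, e \notin A -> c e = 0) ->
  \sum_(e : A) c (val e) * divergence (delta R (val e)) p = divergence c p.
Proof. by move=> c0; rewrite -divergence_sum /divergence !(sum_fset_delta _
  c0). Qed.

Lemma boundary_fset_sum (R : comNzRingType) (A : {fset point}) (h : point -> R)
    e :
  (forall s, s \notin A -> h s = 0) ->
  \sum_(s : A) h (val s) * boundary (delta R (val s)) e = boundary h e.
Proof.
by move=> h0; rewrite -boundary_sum; case: e => p [] /=;
  rewrite !(sum_fset_delta _ h0).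
Qed.

Lemma divergenceB (R : comNzRingType) (c d : ledge -> R) p :
  divergence (fun e => c e - d e) p = divergence c p - divergence d p.
Proof. by rewrite /divergence; ring. Qed.

Lemma divergenceD (R : comNzRingType) (c d : ledge -> R) p :
  divergence (fun e => c e + d e) p = divergence c p + divergence d p.
Proof. by rewrite /divergence; ring. Qed.

Lemma unimodular_rows (m : nat) (L : 'M[int]_m) :
  (forall i, (exists x : 'rV_m, x *m L = delta_mx 0 i)) -> `|\det L| = 1.
Proof.
move=> rows.
have [x xL] : exists x : 'I_m -> 'rV[int]_m, forall i, x i *m L = delta_mx 0 i.
  exact: (fin_all_exists rows).
have XL : (\matrix_i x i) *m L = 1%:M.
  by apply/row_matrixP => i; rewrite row_mul rowK xL row1.
have detXL : \det (\matrix_i x i) * \det L = 1 by rewrite -det_mulmx XL det1.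
have : \det L \is a GRing.unit.
  by apply/unitrPr; exists (\det (\matrix_i x i)); rewrite mulrC.
by rewrite qualifE /= => /orP[] /eqP->.
Qed.

Section Graph.
Variables (G : lattice_graph).
Hypotheses (hconn : connected_graph G) (hfaces : bounded_faces_are_squares G).

Lemma edge_verts e : e \in edges G -> e.1 \in verts G /\ edge_head e \in verts
    G.
Proof.
move=> eE; have endsV := edges_ends eE; split; apply: endsV;
  first exact: mem_head.
by rewrite !inE eqxx orbT.
Qed.

(** Zero boundary off the edges is invariance under [cross], and finite support gives the value 0
    far away. *)
Lemma cochain_off_edges (R : comNzRingType) (h : point -> R) :
    fin_chain2 h -> (forall e, e \notin edges G -> boundary h e = 0) ->
  forall s, s \notin faces G -> h s = 0.
Proof.
move=> fin_h h0; apply: cross_invariant_outer => //.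
move=> s s' [e [eE es es']]; move: (h0 e eE) es es'; rewrite !mem_sides.
have -> : boundary h e = if e.2 then h (other_square e) - h e.1 else h e.1 - h
  (other_square e).
  by case: (e) => p [].
case: ifP => _ /subr0_eq eq_h /orP[] /eqP-> /orP[] /eqP->; rewrite ?eq_h //.
Qed.

Lemma connected_const (T : Type) (phi : point -> T) :
    (forall e, e \in edges G -> phi (edge_head e) = phi e.1) ->
  {in verts G &, forall u v, phi u = phi v}.
Proof.
move=> phiE u v uV vV; have /connectP[p] := hconn [` uV]%fset [` vV]%fset.
elim: p u uV => [|w p IHp] u uV /=; first by move=> _ [->].
case/andP=> /existsP[e /and3P[_ ue we]] w_path v_last;
  rewrite -(IHp _ (valP w)).
- by have := phiE _ (valP e); move: ue we;
    rewrite /= !mem_ends => /orP[] /eqP-> /orP[] /eqP->.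
- by rewrite (_ : [` valP w]%fset = w) //; apply: val_inj.
- by rewrite v_last; congr last; apply: val_inj.
Qed.

Lemma euler_graph : (0 < #|{: faces G}|)%N ->
  (#|{: verts G}| + #|{: faces G}| = #|{: edges G}| + 1)%N.
Proof.
case/card_gt0P=> s _; apply: (@euler bool).
- exact: edges_ends.
- by move=> {}s /facesP.
- apply/fset0Pn; exists (val s); have /facesP sE := valP s.
  by case: (edge_verts (sE (val s, false) (mem_head _ _))).
- exact: connected_const.
- exact: cochain_off_edges.
Qed.

Lemma path_chain (u v : verts G) : exists2 c : ledge -> int,
  (forall e, e \notin edges G -> c e = 0) &
  forall p, divergence c p = (p == val v)%:R - (p == val u)%:R.
Proof.
have /connectP[p] := hconn u v.
elim: p u => [|w p IHp] u /=.
  by move=> _ ->; exists (fun _ => 0) => // p; rewrite /divergence !subrr.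
case/andP=> /existsP[e /and3P[ne_uw ue we]] w_path v_last.
have [c c0 div_c] := IHp w w_path v_last.
have [d d0 div_d] : exists2 d : ledge -> int, (forall e, e \notin edges G -> d
  e = 0) &
    forall p, divergence d p = (p == val w)%:R - (p == val u)%:R.
  have delta0 e' : e' \notin edges G -> delta int (val e) e' = 0.
    by move=> eN; rewrite /delta; case: eqP => // eq_e;
      rewrite eq_e (valP e) in eN.
  move: ne_uw ue we; rewrite -val_eqE !mem_ends => ne /orP[] /eqP eq_u /orP[]
    /eqP eq_w.
  - by rewrite eq_u eq_w eqxx in ne.
  - exists (delta int (val e)) => // p'; rewrite divergence_delta eq_w eq_u //.
  - exists (fun e' => 0 - delta int (val e) e') => [e' /delta0 ->|p'];
      first by rewrite subr0.
    rewrite (@divergenceB _ (fun _ => 0)) divergence_delta eq_u eq_w.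
    by rewrite {1}/divergence; ring.
  - by rewrite eq_u eq_w eqxx in ne.
exists (fun e => c e + d e) => [e' eN|p']; first by rewrite c0 ?d0 ?addr0.
by rewrite divergenceD div_c div_d; ring.
Qed.

Lemma circulation_faces (c : ledge -> int) :
    (forall e, e \notin edges G -> c e = 0) -> (forall p, divergence c p = 0) ->
  exists h : point -> int, forall e,
    c e = \sum_(s : faces G) h (val s) * boundary (delta int (val s)) e.
Proof.
move=> c0 div_c; have [h fin_h hc] := exact_chain (fin_chain1_fset c0) div_c.
exists h => e; rewrite boundary_fset_sum ?hc //;
  apply: cochain_off_edges => // e'.
by rewrite hc; apply: c0.
Qed.

End Graph.

(** * The matrix [K] *)

Lemma shared_side s s' : s != s' ->
  (count (mem (sides s')) (sides s) <= 1)%N.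
Proof.
case: s s' => x y [x' y']; rewrite xpair_eqE => ne.
by rewrite /= !inE /shift /= !addr0 !xpair_eqE /=; lia.
Qed.

Section Kmx.
Variable G : lattice_graph.

Lemma sum_edges_sides (s : faces G) (u : ledge -> int) :
  (forall e, e \notin sides (val s) -> u e = 0) ->
  \sum_(e : edges G) u (val e) = \sum_(e <- sides (val s)) u e.
Proof.
move=> u0; have /facesP sE := valP s.
rewrite -(big_mem_uniq (A := edges G) _ u (uniq_sides _) sE) [RHS]big_mkcond.
by apply: eq_bigr => e _; case: ifP => // /negbT/u0.
Qed.

Lemma boundary_sides s e : boundary (delta int s) e =
  if e \in sides s then if s == e.1 then (-1) ^+ e.2 else - (-1) ^+ e.2 else 0.
Proof.
case: ifP => [|/negbT]; last exact: boundary_delta0.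
have ne := other_square_neq e; rewrite mem_sides => /orP[] /eqP->.
  rewrite eqxx; case: e ne => p [];
    rewrite /delta /other_square /= => /negbTE->; rewrite eqxx.
    by rewrite sub0r.
  by rewrite subr0.
rewrite (negbTE ne); case: e ne => p [];
  rewrite /delta /other_square /= eq_sym => /negbTE->; rewrite eqxx.
  by rewrite subr0 opprK.
by rewrite sub0r.
Qed.

(** [K] is the Gram matrix of the face boundaries: a face has four sides, and a side shared by two
    faces is oriented oppositely by them. *)
Lemma laplacian (s s' : faces G) :
  \sum_(e : edges G) boundary (delta int (val s)) (val e) * boundary (delta int
    (val s')) (val e)
   = if s == s' then 4 else if Defs.adj1 s s' then -1 else 0.
Proof.
transitivity (\sum_(e <- sides (val s))
    boundary (delta int (val s)) e * boundary (delta int (val s')) e).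
  apply: (@sum_edges_sides s (fun e => boundary (delta int (val s)) e
    * boundary (delta int (val s')) e)) => e /boundary_delta0 ->.
  exact: mul0r.
have [<-|ne] := eqVneq s s'.
  under eq_big_seq => e es.
    rewrite boundary_sides es (_ : _ * _ = 1); first over.
    by case: ifP; case: (e.2).
  by rewrite !big_cons big_nil.
under eq_big_seq => e es.
  have -> : boundary (delta int (val s)) e * boundary (delta int (val s')) e =
    - (e \in sides (val s'))%:R.
    move: es; rewrite !boundary_sides !mem_sides.
    have := other_square_neq e; move: ne; rewrite -val_eqE /=.
    move: (val s) (val s') => u v.
    case: (u =P e.1) => [->|_]; case: (v =P e.1) => [->|_]; rewrite ?eqxx //=.
    - by move=> _ _ _; case: ifP; rewrite ?mulr0 ?oppr0 //; case: (e.2).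
    - by move=> _ _ ->; case: (e.2).
    - by move=> ne1 _ /eqP eu;
        rewrite -eu [v == u]eq_sym (negbTE ne1) mulr0 oppr0.
  over.
rewrite /Defs.adj1 ne sumrN -natr_sum.
have -> : (\sum_(e <- sides (val s)) (e \in sides (val s')) =
          count (mem (sides (val s'))) (sides (val s)))%N 
  by rewrite -sum1_count [RHS]big_mkcond; apply: eq_bigr => e _ /=;
    case: (e \in _).
have : val s != val s' by rewrite val_eqE.
move/shared_side; rewrite has_count; case: (count _ _) => [|[|]] //=.
Qed.

(** Positive definiteness: the quadratic form of [K] is the sum of the squares of the boundary
    coefficients, and [boundary] is injective. *)
Lemma Kmx_unit : Kmx G \in unitmx.
Proof.
rewrite -row_free_unit -kermx_eq0; apply/eqP/row_matrixP => i; rewrite row0.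
have : row i (kermx (Kmx G)) *m Kmx G = 0 by rewrite -row_mul mulmx_ker row0.
set x := row i _ => xK; clearbody x.
pose h : point -> rat := zero_ext x.
pose y (e : edges G) : rat := boundary h (val e).
have yE e : y e = \sum_i x 0 i * boundary (delta rat (val (enum_val i))) (val
  e).
  by rewrite /y /h /zero_ext boundary_sum.
have boundary_int (s : point) e : boundary (delta rat s) e = (boundary (delta
  int s) e)%:~R.
  by case: e => p [] /=; rewrite /delta rmorphB /= !rmorph_nat.
have sum_y2 : \sum_e y e ^+ 2 = 0.
  transitivity ((x *m Kmx G *m x^T) 0 0); last by rewrite xK mul0mx mxE.
  rewrite -mulmxA [RHS]mxE.
  transitivity (\sum_i \sum_j x 0 i * x 0 j * (Kmx G i j)); last first.
    apply: eq_bigr => j _; rewrite [(_ *m _) _ _]mxE mulr_sumr;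
      apply: eq_bigr => l _.
    by rewrite [x^T _ _]mxE; ring.
  pose B (e : edges G) (i : 'I_#|{: faces G}|) :=
    boundary (delta rat (val (enum_val i))) (val e).
  transitivity (\sum_i \sum_j \sum_e x 0 i * x 0 j * (B e i * B e j)).
    transitivity (\sum_e \sum_i \sum_j x 0 i * x 0 j * (B e i * B e j)).
      apply: eq_bigr => e _; rewrite yE expr2 mulr_suml; apply: eq_bigr => l _.
      by rewrite mulr_sumr; apply: eq_bigr => j _; rewrite /B; ring.
    by rewrite exchange_big; apply: eq_bigr => l _; rewrite exchange_big.
  apply: eq_bigr => l _; apply: eq_bigr => j _; rewrite -mulr_sumr;
    congr (_ * _).
  transitivity ((\sum_(e : edges G) boundary (delta int (val (enum_val l)))
    (val e)
      * boundary (delta int (val (enum_val j))) (val e))%:~R : rat).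
    by rewrite rmorph_sum; apply: eq_bigr => e _;
      rewrite rmorphM /= /B !boundary_int.
  rewrite laplacian mxE (inj_eq enum_val_inj).
  by do 2?case: ifP => _; rewrite ?rmorphN.
apply/rowP => j; rewrite mxE.
have h_off p : p \notin faces G -> h p = 0 by apply: zero_ext_out.
rewrite -zero_extE.
apply: boundary_inj => [|e]; first exact: fin_chain2_fset h_off.
have [eE|eN] := boolP (e \in edges G); last first.
  rewrite /zero_ext boundary_sum big1 // => l _;
    rewrite boundary_delta0 ?mulr0 //.
  by apply: contra eN; have /facesP sE := valP (enum_val l); apply: sE.
have /(_ [` eE]%fset isT)/eqP := psumr_eq0P (fun (e : edges G) _ => sqr_ge0 (y
  e)) sum_y2.
by rewrite sqrf_eq0 => /eqP.
Qed.

End Kmx.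

(** * Reduction of the Kasteleyn determinant *)

Section ColIndex.
Variables (G : lattice_graph) (n : nat).
Local Notation m := (#|{: faces G}| + n + #|{: verts G}|)%N.

Definition col_of (i : 'I_m) : gk_col G n :=
  match split i with
  | inl i1 => match split i1 with
              | inl s => inl (inl (enum_val s))
              | inr j => inl (inr j)
              end
  | inr v => inr (enum_val v)
  end.

Definition of_col (c : gk_col G n) : 'I_m :=
  match c with
  | inl (inl s) => lshift _ (lshift _ (enum_rank s))
  | inl (inr j) => lshift _ (rshift _ j)
  | inr v => rshift _ (enum_rank v)
  end.

Lemma col_ofK : cancel col_of of_col.
Proof.
move=> i; rewrite /col_of; case: splitP => [i1 eq_i|v eq_i]; last first.
  by apply: val_inj; rewrite /= enum_valK.
case: splitP => [s eq_s|j eq_j]; apply: val_inj => /=;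
  first by rewrite enum_valK eq_i.
by rewrite eq_i.
Qed.

Lemma of_colK : cancel of_col col_of.
Proof.
case=> [[s|j]|v]; rewrite /col_of /of_col.
- by rewrite (unsplitK (inl _)) (unsplitK (inl _)) enum_rankK.
- by rewrite (unsplitK (inl _)) (unsplitK (inr _)).
- by rewrite (unsplitK (inr _)) enum_rankK.
Qed.

Lemma col_of_face s : col_of (lshift _ (lshift _ s)) = inl (inl (enum_val s)).
Proof. by rewrite -[s in LHS]enum_valK -/(of_col (inl (inl _))) of_colK. Qed.

Lemma col_of_term j : col_of (lshift _ (rshift _ j)) = inl (inr j).
Proof. by rewrite -/(of_col (inl (inr _))) of_colK. Qed.

Lemma col_of_vert v : col_of (rshift _ v) = inr (enum_val v).
Proof. by rewrite -[v in LHS]enum_valK -/(of_col (inr _)) of_colK. Qed.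

End ColIndex.

Section Flows.
Variables (G : lattice_graph) (k : nat).
Hypotheses (hconn : connected_graph G) (hfaces : bounded_faces_are_squares G).
Local Notation n := (k + k.-1)%N.
Variables (t : 'I_n -> faces G) (f : 'I_n -> ledge).
Hypotheses (hf : forall i, outer_edge G (f i)) (ht : forall i, f i \in sides
  (val (t i))).
Variables (a : 'I_k -> faces G) (b : 'I_k -> verts G).
Variables (j0 : 'I_k) (j0E : j0 = 0%N :> nat).
Variables (w : 'I_k.-1 -> ledge -> int) (P : verts G -> ledge -> int).
Hypotheses (w0 : forall j e, e \notin edges G -> w j e = 0)
  (w_term : forall j i, w j (f i) = 0)
  (div_w : forall j p, divergence (w j) p =
     (p == val (b (ord_succ j)))%:R - (p == val (b (ord_this j)))%:R).
Hypotheses (P0 : forall v e, e \notin edges G -> P v e = 0)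
  (div_P : forall v p, divergence (P v) p = (p == val v)%:R - (p == val (b
    j0))%:R).

(* Rows of a unimodular integer matrix that brings the bordered Kasteleyn matrix
   to block triangular form: the boundaries of the faces, the unit rows of the
   sites [a j], the boundary flows [w j], and the flows [P v] from [b 0] to
   [v]; the entries in the columns of the [b j] cancel the divergence at the
   sites [b j]. *)
Definition flow_row (c : gk_col G n) (r : gk_row G k) : int :=
  match c, r with
  | inl (inl s), inl e => boundary (delta int (val s)) (val e)
  | inl (inl s), inr _ => 0
  | inl (inr i), r =>
    match split i, r with
    | inl j, inr (inl j') => (j' == j)%:R
    | inr j, inl e => w j (val e)
    | inr j, inr (inr j') => (j' == ord_this j)%:R - (j' == ord_succ j)%:R
    | _, _ => 0
    end
  | inr v, inl e => P v (val e)
  | inr v, inr (inl j) => 0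
  | inr v, inr (inr j) => (j == j0)%:R
  end.

(** Membership in the integer lattice generated by the flow rows; that it contains all unit rows is
    what makes the change of rows unimodular. *)
Definition spanned (u : gk_row G k -> int) : Prop :=
  exists x : gk_col G n -> int, forall r, \sum_c x c * flow_row c r = u r.

Lemma spanned_ext u v : u =1 v -> spanned u -> spanned v.
Proof. by move=> eq_uv [x hx]; exists x => r; rewrite hx eq_uv. Qed.

Lemma spanned_row c : spanned (flow_row c).
Proof.
exists (fun c' => (c' == c)%:R) => r;
  rewrite (bigD1 c) //= eqxx mul1r big1 ?addr0 //.
by move=> c' /negbTE->; rewrite mul0r.
Qed.

Lemma spannedB u v : spanned u -> spanned v -> spanned (fun r => u r - v r).
Proof.
move=> [x hx] [y hy]; exists (fun c => x c - y c) => r.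
by rewrite -hx -hy -sumrB; apply: eq_bigr => c _; rewrite mulrBl.
Qed.

Lemma spannedD u v : spanned u -> spanned v -> spanned (fun r => u r + v r).
Proof.
move=> [x hx] [y hy]; exists (fun c => x c + y c) => r.
by rewrite -hx -hy -big_split; apply: eq_bigr => c _; rewrite mulrDl.
Qed.

Definition edge_part (z : ledge -> int) (r : gk_row G k) : int :=
  if r is inl e then z (val e) else 0.

Lemma spanned_circulation (z : ledge -> int) :
    (forall e, e \notin edges G -> z e = 0) -> (forall p, divergence z p = 0) ->
  spanned (edge_part z).
Proof.
move=> z0 /(circulation_faces hfaces z0)[h hz].
exists (fun c => if c is inl (inl s) then h (val s) else 0) => r.
rewrite !big_sumType /= [X in _ + X + _]big1 => [|i _]; last by rewrite mul0r.
rewrite [X in _ + X]big1 ?addr0 => [|i _]; last by rewrite mul0r.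
case: r => [e|r] /=; first by rewrite hz.
by rewrite big1 // => s _; rewrite mulr0.
Qed.

Lemma spanned_face_row j : spanned (fun r => (r == inr (inl j))%:R).
Proof.
apply: spanned_ext (spanned_row (inl (inr (lshift _ j)))) => r /=.
by rewrite (unsplitK (inl _)); case: r => [e|[]].
Qed.

(** For [j0], the flow [P (b j0)] is a circulation, and removing it leaves the unit row. Then [P (b
    (ord_succ j1)) - P (b (ord_this j1)) - w j1] is a circulation too, which carries the unit row
    from one impurity to the next. *)
Lemma spanned_vert_row j : spanned (fun r => (r == inr (inr j))%:R).
Proof.
case: j => j; elim: j => [|j IHj] lt_j.
  have -> : Ordinal lt_j = j0 by apply: val_inj; rewrite /= j0E.
  have circ : spanned (edge_part (P (b j0))).
    by apply: spanned_circulation => [|p]; [exact: P0 | rewrite div_P subrr].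
  apply: spanned_ext (spannedB (spanned_row (inr (b j0))) circ) => r.
  by case: r => [e|[j|j]]; rewrite /= ?subrr ?subr0.
have lt_j1 : (j < k.-1)%N by lia.
pose j1 := Ordinal lt_j1.
have succ_j1 : ord_succ j1 = Ordinal lt_j by apply: val_inj.
have this_j1 : ord_this j1 = Ordinal (ltnW lt_j) by apply: val_inj.
pose z e := P (b (ord_succ j1)) e - P (b (ord_this j1)) e - w j1 e.
have circ : spanned (edge_part z).
  apply: spanned_circulation => [e eN|p]; first by rewrite /z !P0 ?w0 ?subrr.
  by rewrite !divergenceB !div_P div_w; ring.
have := spannedB (spannedD (IHj (ltnW lt_j)) (spannedB (spanned_row (inr (b
  (ord_succ j1))))
  (spanned_row (inr (b (ord_this j1))))))
  (spannedD (spanned_row (inl (inr (rshift _ j1)))) circ).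
apply: spanned_ext => r /=; rewrite (unsplitK (inr _)) -succ_j1 -this_j1.
case: r => [e|[j'|j']] /=; rewrite /z.
- by ring.
- by rewrite !subrr.
- by rewrite ![inr _ == _]/eq_op /=; ring.
Qed.

(** The edge closes the flows from the base point to its two ends into a circulation. *)
Lemma spanned_edge_row (e : edges G) : spanned (fun r => (r == inl e)%:R).
Proof.
have eE := valP e; have [V1 V2] := edge_verts eE.
pose u := [` V1]%fset; pose v := [` V2]%fset.
pose z e' := P v e' - P u e' - delta int (val e) e'.
have circ : spanned (edge_part z).
  apply: spanned_circulation => [e' eN|p].
    rewrite /z !P0 // /delta; case: eqP => [eq_e|]; last by rewrite subrr.
    by rewrite eq_e eE in eN.
  by rewrite !divergenceB !div_P divergence_delta /=; ring.
have := spannedB (spannedB (spanned_row (inr v)) (spanned_row (inr u))) circ.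
apply: spanned_ext => r /=; case: r => [e'|[j'|j']] /=;
  rewrite ?subrr // /z /delta.
by rewrite [inl _ == _]/eq_op /= -val_eqE /=; ring.
Qed.

Lemma spanned_unit (r0 : gk_row G k) : spanned (fun r => (r == r0)%:R).
Proof.
by case: r0 => [e|[j|j]];
  [exact: spanned_edge_row | exact: spanned_face_row | exact: spanned_vert_row].
Qed.

(** Entries of the flow rows times the bordered Kasteleyn matrix, computed block by block below. *)
Definition flow_col (c c' : gk_col G n) : int :=
  \sum_r flow_row c r * row_entry t f a b r c'.

Lemma row_entry_face e s : row_entry t f a b (inl e) (inl (inl s)) =
  boundary (delta int (val s)) (val e).
Proof. by rewrite /row_entry /= boundary_sign. Qed.

Lemma row_entry_vert e v : row_entry t f a b (inl e) (inr v) =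
  divergence (delta int (val e)) (val v).
Proof. by rewrite /row_entry /= divergence_sign. Qed.

Lemma row_entry_term e i : row_entry t f a b (inl e) (inl (inr i)) =
  if val e == f i then boundary (delta int (val (t i))) (f i) else 0.
Proof.
by rewrite /row_entry /= boundary_sign; case: eqP => // ->; rewrite ht.
Qed.

Lemma row_entry_extra x c : row_entry t f a b (inr x) c = (row_arc f a b (inr
    x) c)%:R.
Proof. by rewrite /row_entry; case: ifP => //; case: x => j; case: c. Qed.

Lemma flow_colE c c' : flow_col c c' =
  \sum_e flow_row c (inl e) * row_entry t f a b (inl e) c' +
  (\sum_j flow_row c (inr (inl j)) * (row_arc f a b (inr (inl j)) c')%:R +
   \sum_j flow_row c (inr (inr j)) * (row_arc f a b (inr (inr j)) c')%:R).
Proof.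
rewrite /flow_col !big_sumType /=; congr (_ + (_ + _));
by apply: eq_bigr => j _; rewrite row_entry_extra.
Qed.

Lemma sum_term (u : ledge -> int) i :
  \sum_(e : edges G) u (val e) * row_entry t f a b (inl e) (inl (inr i)) =
  u (f i) * boundary (delta int (val (t i))) (f i).
Proof.
have [fE _] := hf i; rewrite (bigD1 [` fE]%fset) //= row_entry_term eqxx.
rewrite big1 ?addr0 // => e; rewrite -val_eqE /= => /negbTE ne.
by rewrite row_entry_term ne mulr0.
Qed.

(** One of the two squares at [f i] lies in the outer face, which leaves room for a single face. *)
Lemma face_of_term (s : faces G) i : f i \in sides (val s) -> s = t i.
Proof.
have [_ [s1 fs1 /outer_not_face s1N]] := hf i; have := ht i.
move: fs1; rewrite !mem_sides => fs1 ft fs; apply: val_inj.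
have ne1 : val s != s1 by apply: contraNneq s1N => <-; apply: valP.
have ne2 : val (t i) != s1 by apply: contraNneq s1N => <-; apply: valP.
by case/orP: fs1 ne1 ne2 => /eqP->; case/orP: ft => /eqP->;
  case/orP: fs => /eqP->; rewrite ?eqxx.
Qed.

Lemma flow_col_face_face s s' : flow_col (inl (inl s)) (inl (inl s')) =
  if s == s' then 4 else if Defs.adj1 s s' then -1 else 0.
Proof.
rewrite flow_colE /= [X in _ + (X + _)]big1 => [|j _]; last by rewrite mul0r.
rewrite [X in _ + (_ + X)]big1 => [|j _]; last by rewrite mul0r.
by rewrite !addr0 -laplacian; apply: eq_bigr => e _; rewrite row_entry_face.
Qed.

Lemma flow_col_face_term s i : flow_col (inl (inl s)) (inl (inr i)) = (s == t
    i)%:R.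
Proof.
rewrite flow_colE /= [X in _ + (X + _)]big1 => [|j _]; last by rewrite mul0r.
rewrite [X in _ + (_ + X)]big1 => [|j _]; last by rewrite mul0r.
rewrite !addr0 (sum_term (boundary (delta int (val s)))).
case: eqP => [->|ne]; first by rewrite boundary_sign ht -signr_addb addbb.
rewrite boundary_delta0 ?mul0r //; apply/negP => /face_of_term; exact: ne.
Qed.

Lemma flow_col_face_vert s v : flow_col (inl (inl s)) (inr v) = 0.
Proof.
rewrite flow_colE /= [X in _ + (X + _)]big1 => [|j _]; last by rewrite mul0r.
rewrite [X in _ + (_ + X)]big1 => [|j _]; last by rewrite mul0r.
rewrite !addr0; under eq_bigr do rewrite row_entry_vert.
rewrite (@divergence_fset_sum _ _ (boundary (delta int (val s))))
  ?divergence_boundary //.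
move=> e eN; apply: boundary_delta0; apply: contra eN.
by have /facesP sE := valP s; apply: sE.
Qed.

Lemma flow_col_impurity j c : flow_col (inl (inr (lshift _ j))) c =
  (row_arc f a b (inr (inl j)) c)%:R.
Proof.
rewrite flow_colE /= (unsplitK (inl _)) big1 ?add0r => [|e _];
  last by rewrite mul0r.
rewrite [X in _ + X]big1 ?addr0 => [|j' _]; last by rewrite mul0r.
rewrite (bigD1 j) //= eqxx mul1r big1 ?addr0 // => j' /negbTE->.
by rewrite mul0r.
Qed.

Lemma flow_col_flow_face j s : flow_col (inl (inr (rshift _ j))) (inl (inl s)) =
  \sum_(e : edges G) w j (val e) * boundary (delta int (val s)) (val e).
Proof.
rewrite flow_colE /= (unsplitK (inr _)) [X in _ + (X + _)]big1 => [|j' _];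
  last by rewrite mul0r.
rewrite [X in _ + (_ + X)]big1 => [|j' _]; last by rewrite mulr0.
by rewrite !addr0; apply: eq_bigr => e _; rewrite row_entry_face.
Qed.

Lemma flow_col_flow_term j i : flow_col (inl (inr (rshift _ j))) (inl (inr i))
    = 0.
Proof.
rewrite flow_colE /= (unsplitK (inr _)) [X in _ + (X + _)]big1 => [|j' _];
  last by rewrite mul0r.
rewrite [X in _ + (_ + X)]big1 => [|j' _]; last by rewrite mulr0.
by rewrite !addr0 (sum_term (w j)) w_term mul0r.
Qed.

Lemma sum_eqr (I : finType) (j1 : I) (u : I -> int) :
  \sum_j (j == j1)%:R * u j = u j1.
Proof.
rewrite (bigD1 j1) //= eqxx mul1r big1 ?addr0 // => j /negbTE->.
by rewrite mul0r.
Qed.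

Lemma flow_col_flow_vert j v : flow_col (inl (inr (rshift _ j))) (inr v) = 0.
Proof.
rewrite flow_colE /= (unsplitK (inr _)) [X in _ + (X + _)]big1 => [|j' _];
  last by rewrite mul0r.
under [X in X + _]eq_bigr do rewrite row_entry_vert.
rewrite (@divergence_fset_sum _ _ (w j)) => [|e]; last exact: w0.
under [X in _ + (_ + X)]eq_bigr do rewrite mulrBl.
by rewrite sumrB !sum_eqr div_w add0r !val_eqE; ring.
Qed.

Lemma flow_col_vert_vert u v : flow_col (inr u) (inr v) = (v == u)%:R.
Proof.
rewrite flow_colE /= [X in _ + (X + _)]big1 => [|j' _]; last by rewrite mul0r.
under [X in X + _]eq_bigr do rewrite row_entry_vert.
rewrite (@divergence_fset_sum _ _ (P u)) => [|e]; last exact: P0.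
by rewrite sum_eqr div_P add0r !val_eqE; ring.
Qed.

Local Notation m := (#|{: faces G}| + n + #|{: verts G}|)%N.

Definition flow_boundary_mx : 'M[int]_(n, #|{: faces G}|) :=
  \matrix_(i, s) flow_col (inl (inr i)) (inl (inl (enum_val s))).

(** Schur complement of [K]: the impurity and flow rows vanish in the terminal columns, and the
    vertex columns carry only an identity block. *)
Lemma det_flow_col :
  (\det (\matrix_(i < m, j < m) flow_col (col_of i) (col_of j)))%:~R =
  \det (Kmx G) * \det (- (map_mx intr flow_boundary_mx *m invmx (Kmx G) *m
    \matrix_(s, i) (enum_val s == t i)%:R)) :> rat.
Proof.
set N := \matrix_(i, j) _; set Z := map_mx intr _; set Et := \matrix_(s, i) _.
pose D : 'M[rat]_(#|{: verts G}|, #|{: faces G}| + n) :=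
  \matrix_(v, i) (flow_col (inr (enum_val v)) (col_of (lshift _ i)))%:~R.
rewrite -det_map_mx.
have -> : map_mx intr N = block_mx (block_mx (Kmx G) Et Z 0) 0 D 1%:M.
  apply/matrixP => i j; rewrite mxE mxE.
  case: (split_ordP i) => [i1 ->|v ->]; last first.
    rewrite col_of_vert; case: (split_ordP j) => [j1 ->|u ->].
      by rewrite block_mxEdl mxE.
    rewrite block_mxEdr col_of_vert flow_col_vert_vert (inj_eq enum_val_inj)
      !mxE.
    by rewrite eq_sym; case: eqP.
  case: (split_ordP j) => [j1 ->|u ->]; last first.
    rewrite block_mxEur mxE col_of_vert; case: (split_ordP i1) => [s ->|l ->].
      by rewrite col_of_face flow_col_face_vert.
    rewrite col_of_term; case: (split_ordP l) => [l1 ->|l2 ->].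
      by rewrite flow_col_impurity.
    by rewrite flow_col_flow_vert.
  rewrite block_mxEul; case: (split_ordP i1) => [s ->|l ->].
    rewrite col_of_face; case: (split_ordP j1) => [s' ->|l' ->].
      rewrite block_mxEul col_of_face flow_col_face_face mxE (inj_eq
        enum_val_inj).
      by do 2?case: ifP => _; rewrite ?rmorphN.
    rewrite block_mxEur col_of_term flow_col_face_term mxE.
    by case: eqP.
  rewrite col_of_term; case: (split_ordP j1) => [s' ->|l' ->].
    by rewrite block_mxEdl col_of_face !mxE.
  rewrite block_mxEdr col_of_term mxE; case: (split_ordP l) => [l1 ->|l2 ->].
    by rewrite flow_col_impurity.
  by rewrite flow_col_flow_term.
rewrite det_lblock det1 mulr1.
pose U : 'M[rat]_(#|{: faces G}| + n) := block_mx 1%:M 0 (- (Z *m invmx (Kmx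
  G))) 1%:M.
have detU : \det U = 1 by rewrite det_lblock !det1 mulr1.
rewrite -[LHS]mul1r -detU -det_mulmx mulmx_block !mul1mx !mul0mx !addr0.
rewrite !mulNmx -[Z *m _ *m Kmx G]mulmxA mulVmx ?Kmx_unit // mulmx1 addNr.
by rewrite det_ublock.
Qed.

Lemma abs_det_flow (r : 'I_m -> gk_row G k) : bijective r ->
  `|\det (\matrix_(i < m, j < m) row_entry t f a b (r i) (col_of j))|%:~R =
  `|\det (Kmx G) * \det (map_mx intr flow_boundary_mx *m invmx (Kmx G) *m
    \matrix_(s, i) (enum_val s == t i)%:R)| :> rat.
Proof.
move=> r_bij; set M := \matrix_(i, j) _; set X := map_mx intr _ *m _ *m _.
pose L : 'M[int]_m := \matrix_(i, j) flow_row (col_of i) (r j).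
have LM : L *m M = \matrix_(i < m, j < m) flow_col (col_of i) (col_of j).
  apply/matrixP => i j; rewrite !mxE /flow_col (reindex r); last first.
    by case: r_bij => r' rK r'K; exists r' => ? _.
  by apply: eq_bigr => l _; rewrite !mxE.
have detL : `|\det L| = 1.
  apply: unimodular_rows => i; have [x hx] := spanned_unit (r i).
  exists (\row_j x (col_of j)); apply/rowP => j; rewrite !mxE eqxx /=.
  rewrite -(inj_eq (bij_inj r_bij)) -hx (reindex (@col_of G n)); last first.
    by exists (@of_col G n) => ? _; [exact: col_ofK | exact: of_colK].
  by apply: eq_bigr => l _; rewrite !mxE.
rewrite -[X in X%:~R]mul1r -detL -normrM -det_mulmx LM intr_norm det_flow_col.
rewrite -/X !normrM; congr (_ * _).
by rewrite -scaleN1r detZ normrM normrX normrN1 expr1n mul1r.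
Qed.

End Flows.

(** * The outer boundary walk *)

(** The unit flow along a dart; edges point east and north, so the other two directions run against
    them. The form [0 - _] lets [divergenceB] apply. *)
Definition dart_chain (d : dart) (e : ledge) : int :=
  match d.2 with East | North => delta int (dart_edge d) e
               | West | South => 0 - delta int (dart_edge d) e end.

Lemma divergence_dart d p :
  divergence (dart_chain d) p = (p == dart_head d)%:R - (p == d.1)%:R.
Proof.
have div0 q : divergence (fun _ : ledge => 0 : int) q = 0 by rewrite
  /divergence; ring.
case: d => [[x y] []]; rewrite /dart_chain /=.
- by rewrite divergence_delta.
- by rewrite divergence_delta.
- rewrite (@divergenceB _ (fun _ => 0)) div0 divergence_delta /edge_head /shift
    /=.
  by rewrite (_ : (x - 1 + 1, y + 0 + 0) = (x, y)); [ring | congr (_, _); ring].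
- rewrite (@divergenceB _ (fun _ => 0)) div0 divergence_delta /edge_head /shift
    /=.
  by rewrite (_ : (x + 0 + 0, y - 1 + 1) = (x, y)); [ring | congr (_, _); ring].
Qed.

Lemma ends_dart_edge d p : (p \in ends (dart_edge d)) = (p == d.1) || (p ==
    dart_head d).
Proof.
by case: d p => [[x y] []] [px py]; rewrite !inE /shift /= !xpair_eqE; lia.
Qed.

Lemma left_square_side d : dart_edge d \in sides (left_square d).
Proof. by case: d => [[x y] []];
  rewrite /= mem_sides /other_square /shift /= !xpair_eqE; lia. Qed.

Lemma dart_chain_edge d : dart_chain d (dart_edge d) =
  if d.2 is (East | North) then 1 else -1.
Proof. by rewrite /dart_chain /delta eqxx; case: (d.2). Qed.

(** A square at the dart other than its left square lies on its right, where the counterclockwise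
    orientation runs against the dart. *)
Lemma dart_chain_boundary d s : s != left_square d ->
  dart_chain d (dart_edge d) * boundary (delta int s) (dart_edge d) =
  - (dart_edge d \in sides s)%:R.
Proof.
move=> ne; rewrite boundary_sides mem_sides dart_chain_edge.
case: s d ne => [sx sy] [[x y] []];
  rewrite /= /other_square /shift /= !xpair_eqE /= => ne;
(case: ifP => [h1|h1]; [case: ifP => h2|]); rewrite /= ?expr0 ?expr1; lia.
Qed.

Section Walk.
Variable G : lattice_graph.

Definition boundary_dart (d : dart) : Prop :=
  dart_edge d \in edges G /\ outer_square G (left_square d).

Lemma cross_outer s s' : cross G s s' -> outer_square G s -> outer_square G s'.
Proof.
move=> ss' out N; have [s2 s_s2 far_s2] := out N; exists s2 => //.
apply: rt_trans s_s2; apply: rt_step; case: ss' => e [eN es es'].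
by exists e.
Qed.

Lemma next_dart_tail d : (next_dart G d).1 = dart_head d.
Proof. by rewrite /next_dart; do 3?case: ifP. Qed.

(** Turning left at the head keeps the left square. Each direction refused afterwards is a missing
    edge, and crossing it leads to the left square of the next direction; if three are refused, the
    walk goes back along the edge of [d]. *)
Lemma next_dart_boundary d : boundary_dart d -> boundary_dart (next_dart G d).
Proof.
case=> dE out; rewrite /next_dart.
have step u : dart_edge (dart_head d, u) \notin edges G ->
    outer_square G (left_square (dart_head d, u)) ->
    outer_square G (left_square (dart_head d, turn_right u)).
  move=> uN; apply: cross_outer; exists (dart_edge (dart_head d, u));
    split=> //.
    exact: left_square_side.
  by case: (dart_head d) u {uN} => x y [];
    rewrite /= mem_sides /other_square /shift /= !xpair_eqE; lia.
have out0 : outer_square G (left_square (dart_head d, turn_left d.2)).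
  suff -> : left_square (dart_head d, turn_left d.2) = left_square d by [].
  by case: (d) => [[x y] []]; rewrite /= /shift /=; congr (_, _); ring.
have rl u : turn_right (turn_left u) = u by case: u.
case: ifP => [|/negbT e1]; first by split.
have := step _ e1 out0; rewrite rl => out1.
case: ifP => [|/negbT e2]; first by split.
have out2 := step _ e2 out1.
case: ifP => [|/negbT e3]; first by split.
have := step _ e3 out2;
  have -> : turn_right (turn_right d.2) = turn_back d.2 by case: (d.2).
split=> //; have -> // : dart_edge (dart_head d, turn_back d.2) = dart_edge d.
by case: (d) => [[x y] []]; rewrite /= /shift /=; congr (_, _, _); ring.
Qed.

(* [z i] is the unit flow along the [i]-th edge of [es], from [tl i] to
   [tl i.+1]; [kappa] records the sense in which the outer boundary is
   followed. *)
Definition walk (es : seq ledge) (z : nat -> ledge -> int) (tl : nat -> point)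
    (kappa : int) : Prop :=
  [/\ `|kappa| = 1,
      forall e0 i e, (i < size es)%N -> e != nth e0 es i -> z i e = 0,
      forall i p, (i < size es)%N ->
        divergence (z i) p = (p == tl i.+1)%:R - (p == tl i)%:R,
      forall e0 i p, (i < size es)%N -> p \in ends (nth e0 es i) -> p = tl i \/
        p = tl i.+1
    & forall e0 i s, (i < size es)%N -> s \in faces G ->
        z i (nth e0 es i) * boundary (delta int s) (nth e0 es i) =
        - kappa * (nth e0 es i \in sides s)%:R].

(** The last clause deals with bridges: [index] finds only the first visit to a repeated edge, and
    this cannot distort a count of faces when such an edge borders none. *)
Definition outer_seq (es : seq ledge) : Prop :=
  [/\ {subset es <= edges G},
      forall e s s', e \in es -> s \in faces G -> s' \in faces G ->
        e \in sides s -> e \in sides s' -> s = s'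
    & forall e0 i j, (i < size es)%N -> (j < size es)%N -> nth e0 es i = nth e0
      es j ->
        i <> j -> forall s, s \in faces G -> nth e0 es i \notin sides s].

(** Distinct darts on one edge are opposite, so their left squares are the two squares at the
    edge. *)
Lemma dart_opposite d d' : dart_edge d = dart_edge d' -> d <> d' ->
  forall s, dart_edge d \in sides s -> s = left_square d \/ s = left_square d'.
Proof.
move=> eq_e ne s es; have l1 := left_square_side d;
  have l2 := left_square_side d'.
have ne_l : left_square d != left_square d'.
  apply/eqP => eq_l; apply: ne; move: eq_e eq_l {es l1 l2}.
  case: d d' => [[x y] u] [[x' y'] u'].
  by case: u; case: u'; rewrite /= /shift /= => /eqP;
    rewrite !xpair_eqE /= => h1 /eqP;
     rewrite !xpair_eqE => h2; first [exfalso; lia | congr (_, _, _); lia].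
move: l1 l2 es; rewrite -eq_e !mem_sides => /orP[] /eqP l1 /orP[] /eqP l2
  /orP[] /eqP->;
by [left | right | rewrite l1 l2 eqxx in ne_l].
Qed.

Lemma boundary_portion_walk es : boundary_portion G es ->
  (exists z tl kappa, walk es z tl kappa) /\ outer_seq es.
Proof.
case=> d [n [/= dE out ds_uniq es_ds]].
pose D i := iter i (next_dart G) d.
have bD i : boundary_dart (D i).
  by elim: i => [|i IHi]; [split | rewrite /D iterS; apply: next_dart_boundary].
have D_tail i : (D i.+1).1 = dart_head (D i) by rewrite /D iterS next_dart_tail.
have nthD e0 i : (i < n)%N -> nth e0 (map dart_edge (traject (next_dart G) d
  n)) i = dart_edge (D i).
  by move=> lt_i; rewrite (nth_map d) ?size_traject // nth_traject.
have D_inj i j : (i < j < n)%N -> D i <> D j.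
  move=> /[dup] lt_ij /ds_uniq; have [/andP[lt1 lt2]] := lt_ij.
  by rewrite !nth_traject // (ltn_trans lt1).
have D_ne i j : (i < n)%N -> (j < n)%N -> i <> j -> D i <> D j.
  move=> lt_i lt_j ne; case: (ltngtP i j) => // [lt_ij|lt_ji].
    by apply: D_inj; rewrite lt_ij.
  by move/esym; apply: D_inj; rewrite lt_ji.
have face_left i s : s \in faces G -> s != left_square (D i).
  by move=> sF; have [_ /outer_not_face] := bD i; apply: contraNneq => <-.
have sz : size es = n by case: es_ds => ->;
  rewrite ?size_rev size_map size_traject.
have [pos [pos_lt nth_es pos_inj]] : exists pos, 
    [/\ forall i, (i < n)%N -> (pos i < n)%N,
        forall e0 i, (i < n)%N -> nth e0 es i = dart_edge (D (pos i))
      & forall i j, (i < n)%N -> (j < n)%N -> pos i = pos j -> i = j].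
  case: es_ds => ->.
    by exists id; split=> // e0 i; apply: nthD.
  exists (fun i => n - i.+1)%N; split=> [i lt_i|e0 i lt_i|i j lt_i lt_j];
    try lia.
  rewrite nth_rev ?size_map ?size_traject // nthD //; lia.
split; last first.
  split=> [e /(nthP e)[i]|e s s' /(nthP e)[i]|e0 i j]; rewrite sz.
  - by move=> lt_i <-; rewrite nth_es //; case: (bD (pos i)).
  - move=> lt_i <- sF s'F; rewrite nth_es //.
    have := left_square_side (D (pos i)); have := face_left (pos i) _ sF.
    have := face_left (pos i) _ s'F; rewrite !mem_sides.
    move: (left_square _) => q ne1 ne2 /orP[] /eqP eq_q /orP[] /eqP eq_s /orP[]
      /eqP eq_s';
    by move: ne1 ne2; rewrite eq_q ?eq_s ?eq_s' ?eqxx.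
  - move=> lt_i lt_j; rewrite !nth_es // => eq_e ne s sF; apply/negP.
    have ne_D : D (pos i) <> D (pos j).
      by apply: D_ne; rewrite ?pos_lt // => /pos_inj; auto.
    by case/(dart_opposite eq_e ne_D) => eq_s;
      [have := face_left (pos i) _ sF | 
      have := face_left (pos j) _ sF]; rewrite eq_s eqxx.
case: es_ds => es_ds.
  exists (fun i => dart_chain (D i)), (fun i => (D i).1), 1.
  have nth_es' e0 i : (i < size es)%N -> nth e0 es i = dart_edge (D i).
    by rewrite sz es_ds; apply: nthD.
  split=> // [e0 i e lt_i|i p lt_i|e0 i p lt_i|e0 i s lt_i sF].
  - by rewrite nth_es' // /dart_chain /delta => /negbTE->; case: (D i).2.
  - by rewrite divergence_dart D_tail.
  - by rewrite nth_es' // ends_dart_edge D_tail => /orP[] /eqP; auto.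
  - by rewrite nth_es' // dart_chain_boundary ?face_left // mulN1r.
(* In the reversed portion step [i] runs against the dart [D (n - i.+1)], from its head, which is
   the tail of [D (n - i)]. *)
exists (fun i e => 0 - dart_chain (D (n - i.+1)%N) e), (fun i => (D (n -
  i)%N).1), (-1).
have nth_es' e0 i : (i < size es)%N -> nth e0 es i = dart_edge (D (n - i.+1)%N).
  rewrite sz es_ds => lt_i; rewrite nth_rev ?size_map ?size_traject // nthD //;
    lia.
have subnS1 i : (i < size es)%N -> (n - i = (n - i.+1).+1)%N by rewrite sz; lia.
split=> // [e0 i e lt_i|i p lt_i|e0 i p lt_i|e0 i s lt_i sF].
- by rewrite nth_es' // /dart_chain /delta => /negbTE->; case: (D _).2.
- rewrite (@divergenceB _ (fun _ => 0)) divergence_dart (subnS1 i) // D_tail.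
  by rewrite /divergence; ring.
- by rewrite nth_es' // ends_dart_edge (subnS1 i) // D_tail => /orP[] /eqP;
    auto.
- rewrite nth_es' // sub0r mulNr dart_chain_boundary ?face_left //; ring.
Qed.

End Walk.

(** * Flows along the boundary from one impurity to the next *)

Section Flow.
Variables (G : lattice_graph) (es : seq ledge).
Variables (z : nat -> ledge -> int) (tl : nat -> point) (kappa : int).
Hypotheses (hwalk : walk G es z tl kappa) (hes : outer_seq G es).

Lemma index_face e0 i s : (i < size es)%N -> s \in faces G -> nth e0 es i \in
    sides s ->
  index (nth e0 es i) es = i.
Proof.
move=> lt_i sF is_side; have [_ _ uniq_es] := hes.
have in_es : nth e0 es i \in es by apply: mem_nth.
apply/eqP/negPn/negP => /eqP ne.
have := uniq_es e0 _ _ lt_i (_ : index (nth e0 es i) es < size es)%N _ _ s sF.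
rewrite index_mem nth_index // => /(_ in_es erefl) /(_ _)/negP; apply=> //.
exact: nesym.
Qed.

(** Multiplicities in [between] become numbers of positions of the walk, the form in which the
    coefficients of a flow appear. *)
Lemma between_count (g h : ledge) (x y s : faces G) :
  \sum_(u <- between es g h x y) (u == s)%:R =
  (((s != x) && (s != y)) *
   \sum_(index g es + 1 <= i < index h es) (nth g es i \in sides (val s)))%N%:R
     :> int.
Proof.
rewrite -natr_sum /between big_filter; congr (_%:R).
have [sxy|sxy] := boolP ((s != x) && (s != y)); last first.
  rewrite mul0n big1 // => u uxy; case: eqP => // us.
  by rewrite -us uxy in sxy.
rewrite mul1n (big_mkcond (fun u => (u != x) && (u != y))) /=.
transitivity (\sum_(u <- flatten [seq [seq z <- enum {: faces G} | e \in sides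
  (val z)]
   | e <- es & (index g es < index e es < index h es)%N]) (u == s))%N.
  by apply: eq_bigr => u _; case: (u =P s) => [->|_]; rewrite ?sxy //;
    case: ifP.
rewrite big_flatten big_map big_filter /=.
under eq_bigr => e _.
  have -> : (\sum_(u <- [seq z <- enum {: faces G} | e \in sides (val z)]) (u
    == s) =
      (e \in sides (val s)))%N.
    rewrite big_filter big_enum_cond /= big_mkcond (bigD1 s) //= eqxx.
    rewrite big1 ?addn0; first by case: ifP.
    by move=> u /negbTE->; case: ifP.
  over.
rewrite (big_nth g) /=.
transitivity (\sum_(0 <= i < size es | (index g es < i < index h es)%N) (nth g
  es i \in sides (val s)))%N.
  rewrite big_mkcond [RHS]big_mkcond; apply: eq_big_nat => i /andP[_ lt_i] /=.
  have [is_side|_] := boolP (_ \in _); last by do 2?case: ifP.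
  by rewrite (index_face lt_i (valP s) is_side).
have le_h : (index h es <= size es)%N by apply: index_size.
rewrite big_mkcond /=.
have [le_gh|lt_hg] := leqP (index g es + 1) (index h es); last first.
  rewrite [RHS]big_geq ?(ltnW lt_hg) // big1 // => i _; case: ifP => //; lia.
rewrite (@big_cat_nat _ _ _ (index g es + 1)) ?(leq_trans le_gh) //=.
rewrite (@big_cat_nat _ _ _ (index h es) (index g es + 1)) //=.
rewrite big_nat big1 ?add0n => [|i lt_i]; last by case: ifP => //; lia.
rewrite [X in (_ + X)%N]big_nat [X in (_ + X)%N]big1 ?addn0 => [|i lt_i];
  last by case: ifP => //; lia.
by rewrite big_nat [RHS]big_nat; apply: eq_bigr => i lt_i; rewrite ifT //; lia.
Qed.

(** The flow follows [es] from [u] to [v]. Possible use of [g] and [h], and further visits to [x]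
    and [y] in between, only add multiples of the terms of [x] and [y], which [between] leaves
    out. *)
Lemma walk_flow (g h : ledge) (x y : faces G) (u v : verts G) :
    g \in es -> h \in es -> (index g es < index h es)%N ->
    g \in sides (val x) -> h \in sides (val y) ->
    val u \in ends g -> val v \in ends h ->
  exists w : ledge -> int,
  [/\ forall e, e \notin es -> w e = 0,
      forall p, divergence w p = (p == val v)%:R - (p == val u)%:R
    & exists alpha beta : int, forall s : faces G,
        \sum_(e : edges G) w (val e) * boundary (delta int (val s)) (val e) =
        alpha * (x == s)%:R + beta * (y == s)%:R
        - kappa * \sum_(c <- between es g h x y) (c == s)%:R].
Proof.
move=> g_es h_es lt_gh gx hy ug vh.
have [kappa1 z0 div_z tl_ends z_face] := hwalk;
  have [es_edges es_uniq _] := hes.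
have lt_g : (index g es < size es)%N by rewrite index_mem.
have lt_h : (index h es < size es)%N by rewrite index_mem.
pose p := index g es; pose q := index h es.
(* The flow uses [g] exactly when [u] is where the walk enters [g], and uses [h] exactly when [v] is
   not where it enters [h]. *)
pose c0 : int := (val u == tl p)%:R; pose c1 : int := (val v != tl q)%:R.
pose w e := c0 * z p e + (\sum_(p + 1 <= i < q) z i e) + c1 * z q e.
have z_es i e : (i < size es)%N -> e \notin es -> z i e = 0.
  by move=> lt_i eN; apply: (z0 g) => //; apply: contraNneq eN => ->;
    apply: mem_nth.
have w0 e : e \notin es -> w e = 0.
  move=> eN; rewrite /w !z_es // !mulr0 addr0 add0r big_nat big1 // => i lt_i.
  by apply: z_es => //; rewrite /q in lt_i; lia.
have div_w r : divergence w r = c0 * divergence (z p) r +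
    (\sum_(p + 1 <= i < q) divergence (z i) r) + c1 * divergence (z q) r.
  rewrite /divergence /w !(sumrB, big_split) /=; ring.
exists w; split=> // [r|].
  rewrite div_w !div_z //.
  have -> : \sum_(p + 1 <= i < q) divergence (z i) r = (r == tl q)%:R - (r ==
    tl (p + 1)%N)%:R :> int.
    rewrite -(@telescope_sumr _ (p + 1) q (fun i => (r == tl i)%:R));
      last by rewrite addn1.
    by rewrite big_nat [RHS]big_nat; apply: eq_bigr => i lt_i;
      rewrite div_z //; rewrite /q in lt_i; lia.
  have u_tl := tl_ends g p (val u) lt_g; rewrite nth_index // in u_tl.
  have v_tl := tl_ends h q (val v) lt_h; rewrite nth_index // in v_tl.
  rewrite addn1 /c0 /c1.
  case: (val u =P tl p) => [->|ne_u]; case: (val v =P tl q) => [->|ne_v] /=.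
  - by ring.
  - by case: (v_tl vh) => // ->; ring.
  - by case: (u_tl ug) => // ->; ring.
  - by case: (u_tl ug) => // ->; case: (v_tl vh) => // ->; ring.
have z_sum i (s : faces G) : (i < size es)%N ->
    \sum_(e : edges G) z i (val e) * boundary (delta int (val s)) (val e) =
    - kappa * (nth g es i \in sides (val s))%:R.
  move=> lt_i; have iE : nth g es i \in edges G by apply: es_edges;
    apply: mem_nth.
  rewrite (bigD1 [` iE]%fset) //= z_face ?(valP s) // big1 ?addr0 // => e.
  by rewrite -val_eqE /= => ne; rewrite (z0 g) ?mul0r.
pose N (s : faces G) : nat := (\sum_(p + 1 <= i < q) (nth g es i \in sides (val
  s)))%N.
have sum_w (s : faces G) : \sum_(e : edges G) w (val e) * boundary (delta int
  (val s)) (val e) =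
    - kappa * (c0 * (x == s)%:R + (N s)%:R + c1 * (y == s)%:R).
  transitivity (c0 * (\sum_(e : edges G) z p (val e) * boundary (delta int (val
    s)) (val e))
    + \sum_(p + 1 <= i < q) (\sum_(e : edges G) z i (val e) * boundary (delta
        int (val s)) (val e))
    + c1 * (\sum_(e : edges G) z q (val e) * boundary (delta int (val s)) (val
        e))).
    rewrite exchange_big /= !mulr_sumr -!big_split; apply: eq_bigr => e _ /=.
    by rewrite -mulr_suml /w; ring.
  have face_eq (e : ledge) (s1 : faces G) : e \in es -> e \in sides (val s1) -> 
      (e \in sides (val s)) = (s1 == s).
    move=> e_es es1; apply/idP/eqP => [es2|<- //]; apply: val_inj.
    exact: es_uniq e_es (valP s1) (valP s) es1 es2.
  rewrite !z_sum // !nth_index // (face_eq g x) // (face_eq h y) //.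
  rewrite (_ : \sum_(p + 1 <= i < q) _ = - kappa * (N s)%:R); first by ring.
  rewrite /N natr_sum mulr_sumr big_nat [RHS]big_nat; apply: eq_bigr => i lt_i.
  by rewrite z_sum //; rewrite /q in lt_i; lia.
(* The visits to [x] and [y] missing from [between] go into the coefficients; the 0 avoids counting
   them twice when [x] and [y] coincide. *)
exists (- kappa * (c0 + (N x)%:R)), (- kappa * (c1 + if x == y then 0 else (N
  y)%:R)) => s.
rewrite sum_w between_count -/p -/q -/(N s).
have [eq_x|nx] := eqVneq x s; have [eq_y|ny] := eqVneq y s => /=.
- by rewrite eq_x eq_y ?eqxx mul0n /=; ring.
- by rewrite eq_x ?eqxx mul0n /=; ring.
- by rewrite eq_y ?(negbTE nx) ?eqxx ?andbF mul0n /=; ring.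
- by rewrite mul1n; ring.
Qed.

End Flow.

(** * The determinant formula for boundary impurities *)

Theorem theorem3p6 (k : nat) (hk : (2 <= k)%N)
  (* the lattice graph G_2 *)
  (G : lattice_graph) (hconn : connected_graph G)
  (hfaces : bounded_faces_are_squares G)
  (* the terminals: T_i is joined to t i across the outer boundary edge f i *)
  (t : 'I_(k + k.-1) -> faces G) (f : 'I_(k + k.-1) -> ledge)
  (hf : forall i, outer_edge G (f i))
  (ht : forall i, f i \in sides (val (t i)))
  (* the boundary impurities (a j, b j) *)
  (a : 'I_k -> faces G) (b : 'I_k -> verts G)
  (ha : forall j, boundary1 (a j)) (hb : forall j, boundary2 (b j))
  (* a portion of the outer boundary which carries no terminal and passes
     a_1, ..., a_k in this order, the j-th impurity lying at its edge g j *)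
  (es : seq ledge) (hes : boundary_portion G es)
  (hes_term : forall i, f i \notin es)
  (g : 'I_k -> ledge) (hg : forall j, g j \in es)
  (hg_incr : forall i j : 'I_k, (i < j)%N -> (index (g i) es < index (g j) es)%N)
  (hag : forall j, g j \in sides (val (a j)))
  (hbg : forall j, val (b j) \in ends (g j)) :
  let C (j : 'I_k.-1) := between es (g (ord_this j)) (g (ord_succ j))
                                 (a (ord_this j)) (a (ord_succ j)) in
  (#|matchings_with_impurities f a b|)%:R
    = `|\det (impurity_mx a C t) * \det (Kmx G)|.
Proof.
move=> C.
have k_gt0 : (0 < k)%N by apply: leq_trans hk.
pose j0 := Ordinal k_gt0.
have [[z [tl [kappa hwalk]]] es_outer] := boundary_portion_walk hes.
have [es_edges _ _] := es_outer.
have hab j : val (b j) \in corners (val (a j)) by apply: ends_corners (hbg j).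
have flow_j j : exists w : ledge -> int,
    [/\ forall e, e \notin es -> w e = 0,
        forall p, divergence w p =
          (p == val (b (ord_succ j)))%:R - (p == val (b (ord_this j)))%:R
      & exists alpha beta : int, forall s : faces G,
        \sum_(e : edges G) w (val e) * boundary (delta int (val s)) (val e) =
        alpha * (a (ord_this j) == s)%:R + beta * (a (ord_succ j) == s)%:R
        - kappa * \sum_(c <- C j) (c == s)%:R].
  apply: (walk_flow hwalk es_outer (hg _) (hg _) _ (hag _) (hag _) (hbg _) (hbg
    _)).
  by apply: hg_incr => /=.
have [w hw] := fin_all_exists flow_j.
have w0 j e : e \notin edges G -> w j e = 0.
  by move=> eN; have [w_es _ _] := hw j; apply: w_es; apply: contra eN;
    apply: es_edges.
have w_term j i : w j (f i) = 0 by have [w_es _ _] := hw j; apply: w_es.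
have div_w j p : divergence (w j) p =
    (p == val (b (ord_succ j)))%:R - (p == val (b (ord_this j)))%:R.
  by have [_ -> _] := hw j.
have [P P0 div_P] := fin_all_exists2 (path_chain hconn (b j0)).
pose m := (#|{: faces G}| + (k + k.-1) + #|{: verts G}|)%N.
(* Euler's formula makes the bordered matrix square: the surplus of one in vertices plus faces over
   edges, together with [2k - 1] terminals, balances the [2k] unit rows. *)
have card_row : m = #|gk_row G k|.
  have : (0 < #|{: faces G}|)%N by apply/card_gt0P; exists (a j0).
  move/(euler_graph hconn hfaces) => euler_G.
  transitivity (#|{: edges G}| + (k + k))%N; first by rewrite /m; lia.
  by rewrite !card_sum !card_ord.
pose r (i : 'I_m) : gk_row G k := enum_val (cast_ord card_row i).
pose r' (x : gk_row G k) : 'I_m := cast_ord (esym card_row) (enum_rank x).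
have rK : cancel r r' by move=> i; rewrite /r /r' enum_valK cast_ordK.
have r'K : cancel r' r by move=> x; rewrite /r /r' cast_ordKV enum_rankK.
have r_bij : bijective r by exists r'.
have c_bij : bijective (@col_of G (k + k.-1)).
  by exists (@of_col _ _); [exact: col_ofK | exact: of_colK].
rewrite (card_matchings f rK r'K (@col_ofK _ _) (@of_colK _ _) hab).
have count := abs_det_count t hfaces hf hb hab r_bij c_bij.
have absdet := @abs_det_flow _ _ hfaces _ _ hf ht a b j0 erefl w P w0 w_term
  div_w P0 div_P
  r r_bij.
rewrite pmulrn -count absdet mulrC !normrM; congr (_ * _).
set Z := map_mx _ _; set Et := \matrix_(s, i) _.
have coefs j : exists ab : int * int, forall s : faces G,
    \sum_(e : edges G) w j (val e) * boundary (delta int (val s)) (val e) =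
    ab.1 * (a (ord_this j) == s)%:R + ab.2 * (a (ord_succ j) == s)%:R
    - kappa * \sum_(c <- C j) (c == s)%:R.
  by have [_ _ [al [be h_ab]]] := hw j; exists (al, be).
have [ab hab_w] := fin_all_exists coefs.
(* [B] collects the multiples of the rows of the two neighbouring impurities in each flow row. The
   block triangular factor containing it has determinant a power of [- kappa], of absolute value
   1. *)
pose B : 'M[rat]_(k.-1, k) := \matrix_(j, l)
  ((ab j).1%:~R * (l == ord_this j)%:R + (ab j).2%:~R * (l == ord_succ j)%:R).
have sum_faces (u : faces G -> rat) (x : faces G) : \sum_(s < #|{: faces G}|)
    (x == enum_val s)%:R * u (enum_val s) = u x.
  rewrite (bigD1 (enum_rank x)) //= enum_rankK eqxx mul1r big1 ?addr0 // => s
    ne_s.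
  case: eqP => [eq_x|_]; last by rewrite mul0r.
  by rewrite eq_x enum_valK eqxx in ne_s.
have sum_ord (u : 'I_k -> rat) (l : 'I_k) : \sum_l' (l' == l)%:R * u l' = u l.
  rewrite (bigD1 l) //= eqxx mul1r big1 ?addr0 // => l' /negbTE->.
  by rewrite mul0r.
have -> : Z *m invmx (Kmx G) *m Et =
    block_mx 1%:M 0 B ((- kappa%:~R)%:M) *m impurity_mx a C t.
  have LE s i : (invmx (Kmx G) *m Et) s i = Linv (enum_val s) (t i).
    rewrite mxE (bigD1 (enum_rank (t i))) //= mxE enum_rankK eqxx mulr1 big1
      ?addr0.
      by rewrite /Linv enum_valK.
    move=> s' ne_s'; rewrite mxE; case: eqP => [eq_s|_]; last by rewrite mulr0.
    by rewrite -eq_s enum_valK eqxx in ne_s'.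
  rewrite -mulmxA mul_block_col mul1mx mul0mx addr0 mul_scalar_mx.
  apply/matrixP => l i; rewrite mxE; case: (split_ordP l) => [j ->|j ->].
    rewrite col_mxEu mxE -(sum_faces (fun x => Linv x (t i))).
    by apply: eq_bigr => s _; rewrite LE !mxE flow_col_impurity /= eq_sym;
      case: eqP.
  rewrite col_mxEd !mxE.
  transitivity (\sum_(s < #|{: faces G}|) ((ab j).1%:~R * ((a (ord_this j) ==
    enum_val s)%:R * Linv (enum_val s) (t i))
     + (ab j).2%:~R * ((a (ord_succ j) == enum_val s)%:R * Linv (enum_val s) (t
         i))
     - kappa%:~R * \sum_(c <- C j) ((c == enum_val s)%:R * Linv (enum_val s) (t
         i)))).
    apply: eq_bigr => s _; rewrite LE !mxE flow_col_flow_face hab_w.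
    rewrite rmorphB rmorphD !rmorphM rmorph_sum /= !rmorph_nat -mulr_suml.
    under [X in _ - _ * X]eq_bigr do rewrite rmorph_nat.
    by ring.
  rewrite sumrB big_split /= -!mulr_sumr !(sum_faces (fun x => Linv x (t i))).
  rewrite exchange_big /= mulNr; congr (_ - _ * _); last first.
    by apply: eq_bigr => c _; rewrite (sum_faces (fun x => Linv x (t i))).
  transitivity (\sum_l ((ab j).1%:~R * ((l == ord_this j)%:R * Linv (a l) (t i))
    + (ab j).2%:~R * ((l == ord_succ j)%:R * Linv (a l) (t i)))).
    by rewrite big_split /= -!mulr_sumr !(sum_ord (fun l => Linv (a l) (t i))).
  by apply: eq_bigr => l' _; rewrite !mxE; ring.
have [kappa1 _ _ _ _] := hwalk.
rewrite det_mulmx det_lblock det1 mul1r det_scalar normrM normrX normrN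
  -intr_norm kappa1.
by rewrite expr1n mul1r.
Qed.
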